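(* Let $\mathfrak B$ be a nonempty set of members of $\mathcal{CDD}_N$ and let $\mathbb A,\mathbb B\in\mathcal{CDD}_N$. (A) $\mathfrak B$ has a greatest lower bound with respect to $\le^s$. (B) $\mathfrak B$ has a least upper bound with respect to $\le^s$ if and only if every two-point subset of $\mathfrak B$ is $\le^s$-upper bounded. If the latter happens, $\inf_{\le^s}\mathfrak B=\bigwedge\mathfrak B$ and $\sup_{\le^s}\mathfrak B=\bigvee\mathfrak B$. (C) The following conditions are equivalent: (i) the set $\{\mathbb A,\mathbb B\}$ is $\le^s$-upper bounded; (ii) $\mathbb A\le^s\mathbb A\vee\mathbb B$ and $\mathbb B\le^s\mathbb A\vee\mathbb B$; (iii) $\mathbb A$ and $\mathbb B$ may be written in the forms $\mathbb A=\mathbb E\boxplus\mathbb X$ and $\mathbb B=\mathbb E\boxplus\mathbb Y$ for some $\mathbb E,\mathbb X,\mathbb Y\in\mathcal{CDD}_N$ such that $\mathbb X\perp_u\mathbb Y$. (D) If $\{\mathbb A,\mathbb B\}$ is $\le^s$-upper bounded, then $\mathbb A\le\mathbb B\iff\mathbb A\le^s\mathbb B$.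
   Context: $N\ge 1$ is a fixed integer. Hilbert spaces are complex and of arbitrary dimension (possibly $0$, possibly uncountable). $\mathrm{CDD}_N$ is the class of all $N$-tuples $A=(A_1,\dots,A_N)$ of closed densely defined linear operators acting in a common (arbitrary) Hilbert space; $A$ is trivial if this space is zero-dimensional. For a closed subspace $E$ with orthogonal projection $P_E$: $E\in\mathrm{red}(A)$ means $P_EA_j\subset A_jP_E$ for all $j$; then $A|_E=(A_1|_E,\dots,A_N|_E)$, with $A_j|_E$ the restriction of $A_j$ to $D(A_j)\cap E$, regarded as an operator in $E$. $\mathrm{cred}(A)$ is the set of those $E\in\mathrm{red}(A)$ for which $P_E$ commutes with $P_K$ for all $K\in\mathrm{red}(A)$. $A\equiv B$ means $A_j=U^{-1}B_jU$ for all $j$ for some unitary $U$. $\mathcal{CDD}_N$ is the class of all unitary equivalence classes $\mathbb A$ of members $A$ of $\mathrm{CDD}_N$; $\mathbb O$ is the class of the trivial tuples. Direct sums (coordinatewise, in Hilbert space direct sums) are well defined on $\mathcal{CDD}_N$. For $\mathbb A,\mathbb B\in\mathcal{CDD}_N$ with representatives $A,B$: $\mathbb A\le\mathbb B$ iff $A\equiv B|_E$ for some $E\in\mathrm{red}(B)$; $\mathbb A\le^s\mathbb B$ iff $A\equiv B|_E$ for some $E\in\mathrm{cred}(B)$; $\mathbb A\perp_u\mathbb B$ iff there is no $\mathbb X\ne\mathbb O$ with $\mathbb X\le\mathbb A$ and $\mathbb X\le\mathbb B$. Both $\le$ and $\le^s$ are partial orders on $\mathcal{CDD}_N$. $\bigvee,\vee$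 and $\bigwedge,\wedge$ denote least upper and greatest lower bounds with respect to $\le$ (they exist for all nonempty sets). The notation $\mathbb X\boxplus\mathbb Y$ means $\mathbb X\oplus\mathbb Y$ together with the information $\mathbb X\perp_u\mathbb Y$. *)

(* Defs.v *)
From HB Require Import structures.
From mathcomp Require Import all_boot all_order all_algebra sesquilinear ring.
From mathcomp Require Import complex.
From mathcomp Require Import all_classical reals topology normedtype.
Set Implicit Arguments. Unset Strict Implicit. Unset Printing Implicit Defensive.
Import Order.TTheory GRing.Theory Num.Theory Num.Def.
Import numFieldNormedType.Exports.
Local Open Scope classical_set_scope.
Local Open Scope ring_scope.
Local Open Scope complex_scope.

HB.mixin Record CompleteNormedModule_isHilbert (R : realType) H
    of CompleteNormedModule R[i] H := {
  inner : {dot H for conjC} ;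
  inner_norm : forall x : H, inner x x = `|x| ^+ 2
}.

#[short(type="hilbertType")]
HB.structure Definition Hilbert (R : realType) :=
  {H of CompleteNormedModule R[i] H & CompleteNormedModule_isHilbert R H}.

Arguments inner {R s}.

Section Subspace.
Context {R : realType} {H : hilbertType R}.

Record csubspace := CSubspace {
  csub_set : set H ;
  csub_submod : submod_closed [in csub_set] ;
  csub_closed : closed csub_set
}.

Variable E : csubspace.
Definition csub_pred : {pred H} := [in csub_set E].
HB.instance Definition _ :=
  GRing.isSubmodClosed.Build _ H csub_pred (csub_submod E).

Record csub_type := CSubType { csub_val : H ; csub_valP : csub_val \in csub_pred }.
HB.instance Definition _ := [isSub for csub_val].
HB.instance Definition _ := [Choice of csub_type by <:].
HB.instance Definition _ := [SubChoice_isSubLmodule of csub_type by <:].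

Let norm (x : csub_type) : R[i] := `|val x|.
Let normD x y : norm (x + y) <= norm x + norm y.
Proof. by rewrite /norm raddfD ler_normD. Qed.
Let normZ (a : R[i]) x : norm (a *: x) = `|a| * norm x.
Proof. by rewrite /norm linearZ/= normrZ. Qed.
Let norm_eq0 x : norm x = 0 -> x = 0.
Proof. by move=> /normr0_eq0 x0; apply: val_inj; rewrite x0 raddf0. Qed.
HB.instance Definition _ :=
  @Lmodule_isNormed.Build R[i] csub_type norm normD normZ norm_eq0.

Let complete (F : set_system csub_type) : ProperFilter F -> cauchy F -> cvg F.
Proof.
move=> FF /cauchy_ballP Fc.
have /cvg_ex[l Fl] : cvg (val @ F).
  apply: cauchy_cvg; apply/cauchy_ballP => e e0.
  have [[A B] /= [FA FB] AB] := Fc e e0.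
  exists (val @` A, val @` B) => /=.
    by split; [apply: filterS FA => x Ax|apply: filterS FB => x Bx]; exists x.
  move=> [_ _]/= [[x Ax <-] [y By <-]].
  have := AB (x, y) (conj Ax By).
  by rewrite -!ball_normE /= /ball_/=.
have El : l \in csub_pred.
  rewrite /csub_pred inE; apply: (closed_cvg (csub_set E)) Fl => //.
    exact: csub_closed.
  by apply: nearW => x; have := csub_valP x; rewrite inE.
apply/cvg_ex; exists (CSubType El); apply/cvgrPdist_lt => e e0.
by move/cvgrPdist_lt: Fl => /(_ e e0).
Qed.
HB.instance Definition _ := Uniform_isComplete.Build csub_type complete.

Let ip (x y : csub_type) : R[i] := inner (val x) (val y).
Let ip_bil : bilinear_for *%R (conjC \; *%R) ip.
Proof.
have valP (a : R[i]) (x y : csub_type) : val (a *: x + y) = a *: val x + val y.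
  by [].
split=> [y a x x'|x a y y']; rewrite /ip valP.
- by rewrite linearDl /= linearZl_LR.
- by rewrite linearD /= linearZr_LR.
Qed.
HB.instance Definition _ := bilinear_isBilinear.Build _ _ _ _ _ _ ip ip_bil.
Let ip_herm (x y : csub_type) : ip x y = (-1) ^+ false * (ip y x)^*%R.
Proof. exact: hermC. Qed.
HB.instance Definition _ := isHermitianSesquilinear.Build _ _ _ _ ip ip_herm.
Let ip_pos (x : csub_type) : x != 0 -> 0 < ip x x.
Proof.
move=> x0; apply: neq0_dnorm_gt0.
by apply: contra_neq x0 => x0; apply: val_inj; exact: x0.
Qed.
HB.instance Definition _ := isDotProduct.Build _ _ ip ip_pos.
Let ip_norm (x : csub_type) : ip x x = `|x| ^+ 2.
Proof. exact: inner_norm. Qed.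
HB.instance Definition _ := CompleteNormedModule_isHilbert.Build R csub_type ip_norm.
End Subspace.
Arguments csubspace {R} H.

Section DirectSum.
Context {R : realType} (H K : hilbertType R).

Definition hsum : Type := (H * K)%type.
HB.instance Definition _ := GRing.Lmodule.copy hsum (H * K)%type.

Let norm (x : hsum) : R[i] := sqrtC (`|x.1| ^+ 2 + `|x.2| ^+ 2).
Let norm_ge0 x : 0 <= norm x.
Proof. by rewrite sqrtC_ge0 addr_ge0 ?exprn_ge0. Qed.
Let sqr_norm x : norm x ^+ 2 = `|x.1| ^+ 2 + `|x.2| ^+ 2.
Proof. exact: sqrtCK. Qed.
Let normD x y : norm (x + y) <= norm x + norm y.
Proof.
have cs (a b c d : R[i]) : 0 <= a -> 0 <= b -> 0 <= c -> 0 <= d ->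
    a * c + b * d <= sqrtC (a ^+ 2 + b ^+ 2) * sqrtC (c ^+ 2 + d ^+ 2).
  move=> a0 b0 c0 d0; rewrite -sqrtCM ?nnegrE ?addr_ge0 ?exprn_ge0//.
  rewrite -ler_sqr ?nnegrE ?sqrtC_ge0 ?addr_ge0 ?mulr_ge0 ?addr_ge0 ?exprn_ge0//.
  rewrite sqrtCK -subr_ge0.
  rewrite [leRHS](_ : _ = (a * d - b * c) ^+ 2); last by ring.
  by rewrite real_exprn_even_ge0// rpredB// ger0_real// mulr_ge0.
rewrite -ler_sqr ?nnegrE ?addr_ge0// sqrrD !sqr_norm.
apply: (@le_trans _ _ ((`|x.1| + `|y.1|) ^+ 2 + (`|x.2| + `|y.2|) ^+ 2)).
  by rewrite lerD// ler_sqr ?nnegrE ?addr_ge0// ler_normD.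
have := cs `|x.1| `|x.2| `|y.1| `|y.2|.
move=> /(_ (normr_ge0 _) (normr_ge0 _) (normr_ge0 _) (normr_ge0 _)) xy.
rewrite -subr_ge0 [leRHS](_ : _ =
    (norm x * norm y - (`|x.1| * `|y.1| + `|x.2| * `|y.2|)) *+ 2).
  by rewrite mulrn_wge0// subr_ge0.
by ring.
Qed.
Let normZ (a : R[i]) x : norm (a *: x) = `|a| * norm x.
Proof.
rewrite /norm /= !normrZ !exprMn -mulrDr sqrtCM ?nnegrE ?addr_ge0 ?exprn_ge0//.
by rewrite sqrCK.
Qed.
Let norm_eq0 x : norm x = 0 -> x = 0.
Proof.
move/eqP; rewrite sqrtC_eq0 paddr_eq0 ?exprn_ge0// !sqrf_eq0 !normr_eq0.
by case: x => a b /= /andP[/eqP-> /eqP->].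
Qed.
HB.instance Definition _ :=
  @Lmodule_isNormed.Build R[i] hsum norm normD normZ norm_eq0.

Let norm1 (x : hsum) : `|x.1| <= `|x|.
Proof.
by rewrite -ler_sqr ?nnegrE// [leRHS]sqr_norm lerDl exprn_ge0.
Qed.
Let norm2 (x : hsum) : `|x.2| <= `|x|.
Proof.
by rewrite -ler_sqr ?nnegrE// [leRHS]sqr_norm lerDr exprn_ge0.
Qed.
Let norm_le (x : hsum) : `|x| <= `|x.1| + `|x.2|.
Proof.
rewrite -ler_sqr ?nnegrE ?addr_ge0// [leLHS]sqr_norm sqrrD addrAC lerDl.
by rewrite mulrn_wge0 ?mulr_ge0.
Qed.

Let complete (F : set_system hsum) : ProperFilter F -> cauchy F -> cvg F.
Proof.
move=> FF /cauchy_ballP Fc.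
have cv (L : hilbertType R) (p : hsum -> L) :
    (forall x y, `|p x - p y| <= `|x - y|) -> cvg (p @ F).
  move=> pL; apply: cauchy_cvg; apply/cauchy_ballP => e e0.
  have [[A B] /= [FA FB] AB] := Fc e e0.
  exists (p @` A, p @` B) => /=.
    by split; [apply: filterS FA => x Ax|apply: filterS FB => x Bx]; exists x.
  move=> [_ _]/= [[x Ax <-] [y By <-]].
  have := AB (x, y) (conj Ax By).
  by rewrite -!ball_normE /= /ball_/=; apply: le_lt_trans.
have /cvg_ex[a Fa] : cvg ((fst : hsum -> H) @ F).
  by apply: cv => x y; exact: (norm1 (x - y)).
have /cvg_ex[b Fb] : cvg ((snd : hsum -> K) @ F).
  by apply: cv => x y; exact: (norm2 (x - y)).
apply/cvg_ex; exists ((a, b) : hsum); apply/cvgrPdist_lt => e e0.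
have e20 : 0 < e / 2 by rewrite divr_gt0.
move/cvgrPdist_lt: Fa => /(_ _ e20) Fa; move/cvgrPdist_lt: Fb => /(_ _ e20) Fb.
near=> x; rewrite [e]splitr; apply: le_lt_trans (norm_le _) _.
by apply: ltrD; [near: x; exact: Fa|near: x; exact: Fb].
Unshelve. all: by end_near. Qed.
HB.instance Definition _ := Uniform_isComplete.Build hsum complete.

Let ip (x y : hsum) : R[i] := inner x.1 y.1 + inner x.2 y.2.
Let ip_bil : bilinear_for *%R (conjC \; *%R) ip.
Proof.
split=> [y a x x'|x a y y']; rewrite /ip /=.
- by rewrite !linearDl /= !linearZl_LR /= mulrDr addrACA.
- by rewrite !linearD /= !linearZr_LR /= mulrDr addrACA.
Qed.
HB.instance Definition _ := bilinear_isBilinear.Build _ _ _ _ _ _ ip ip_bil.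
Let ip_norm (x : hsum) : ip x x = `|x| ^+ 2.
Proof. by rewrite /ip !inner_norm [RHS]sqr_norm. Qed.
Let ip_herm (x y : hsum) : ip x y = (-1) ^+ false * (ip y x)^*%R.
Proof.
have innerC (L : hilbertType R) (u v : L) : inner u v = (inner v u)^*%R.
  by rewrite hermC /= mul1r.
by rewrite /ip raddfD /= mul1r -!innerC.
Qed.
HB.instance Definition _ := isHermitianSesquilinear.Build _ _ _ _ ip ip_herm.
Let ip_pos (x : hsum) : x != 0 -> 0 < ip x x.
Proof. by move=> x0; rewrite ip_norm exprn_gt0// normr_gt0. Qed.
HB.instance Definition _ := isDotProduct.Build _ _ ip ip_pos.
HB.instance Definition _ := CompleteNormedModule_isHilbert.Build R hsum ip_norm.

Lemma hsum_fst_continuous : continuous (fst : hsum -> H).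
Proof.
move=> x; apply/(@cvgrPdist_lt _ _ _ _ (nbhs_filter x)) => e e0.
apply/nbhs_ballP; exists e => //= y.
by rewrite -ball_normE; apply: le_lt_trans; exact: (norm1 (x - y)).
Qed.

Lemma hsum_snd_continuous : continuous (snd : hsum -> K).
Proof.
move=> x; apply/(@cvgrPdist_lt _ _ _ _ (nbhs_filter x)) => e e0.
apply/nbhs_ballP; exists e => //= y.
by rewrite -ball_normE; apply: le_lt_trans; exact: (norm2 (x - y)).
Qed.

Lemma hsum_norm_le (x : hsum) : `|x| <= `|x.1| + `|x.2|.
Proof. exact: norm_le. Qed.
End DirectSum.

Section Operators.
Context {R : realType}.

(* A linear operator of H, not necessarily everywhere defined, is identified
   with its graph: [graph A (x, y)] says that x is in the domain of A and A x = y.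
   The inclusion of operators is the inclusion of their graphs. *)
Record operator (H : hilbertType R) := Operator {
  graph : set (H * H) ;
  graph_submod : submod_closed [in graph] ;
  graph_fun : forall x y y', graph (x, y) -> graph (x, y') -> y = y'
}.

Definition domain (H : hilbertType R) (A : operator H) : set H :=
  [set x | exists y, graph A (x, y)].

Definition closed_densely_defined (H : hilbertType R) (A : operator H) :=
  closed (graph A) /\ dense (domain A).

(* The part of A in E; if E reduces A, then A maps [domain A `&` E] into E, so
   that this is the restriction of A to [domain A `&` E]. *)
Definition restr_graph (H : hilbertType R) (A : operator H) (E : csubspace H) :
    set (csub_type E * csub_type E) :=
  [set p | graph A (val p.1, val p.2)].
Arguments restr_graph {H} A E _.

Lemma restr_submod (H : hilbertType R) (A : operator H) (E : csubspace H) :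
  submod_closed [in restr_graph A E].
Proof.
have [A0 AD] := graph_submod A; split.
  by move: A0; rewrite !inE.
by move=> a [x y] [x' y']; rewrite !inE => Axy Axy';
  have := AD a (val x, val y) (val x', val y'); rewrite !inE; apply.
Qed.

Lemma restr_fun (H : hilbertType R) (A : operator H) (E : csubspace H) x y y' :
  restr_graph A E (x, y) -> restr_graph A E (x, y') -> y = y'.
Proof. by move=> Axy Axy'; apply: val_inj; exact: graph_fun Axy Axy'. Qed.

Definition restr_op (H : hilbertType R) (A : operator H) (E : csubspace H) :
    operator (csub_type E) :=
  Operator (restr_submod A E) (@restr_fun H A E).

Definition sum_graph (H K : hilbertType R) (A : operator H) (B : operator K) :
    set (hsum H K * hsum H K) :=
  [set p | graph A (p.1.1, p.2.1) /\ graph B (p.1.2, p.2.2)].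

Lemma sum_submod (H K : hilbertType R) (A : operator H) (B : operator K) :
  submod_closed [in sum_graph A B].
Proof.
have [A0 AD] := graph_submod A; have [B0 BD] := graph_submod B; split.
  by move: A0 B0; rewrite !inE.
move=> a [x y] [x' y']; rewrite !inE => -[Axy Bxy] [Axy' Bxy']; split.
  by have := AD a (x.1, y.1) (x'.1, y'.1); rewrite !inE; apply.
by have := BD a (x.2, y.2) (x'.2, y'.2); rewrite !inE; apply.
Qed.

Lemma sum_fun (H K : hilbertType R) (A : operator H) (B : operator K) x y y' :
  sum_graph A B (x, y) -> sum_graph A B (x, y') -> y = y'.
Proof.
case: y y' => [y1 y2] [y1' y2'] [/= Ay By] [/= Ay' By'].
by rewrite (graph_fun Ay Ay') (graph_fun By By').
Qed.

Definition sum_op (H K : hilbertType R) (A : operator H) (B : operator K) :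
    operator (hsum H K) :=
  Operator (sum_submod A B) (@sum_fun H K A B).

Lemma sum_cdd (H K : hilbertType R) (A : operator H) (B : operator K) :
  closed_densely_defined A -> closed_densely_defined B ->
  closed_densely_defined (sum_op A B).
Proof.
move=> [cA dA] [cB dB]; split.
  have c1 : continuous (fun p : hsum H K * hsum H K => (p.1.1, p.2.1) : H * H).
    move=> p; apply: cvg_pair => /=.
      apply: (@cvg_comp _ _ _ fst fst); first exact: cvg_fst.
      exact: hsum_fst_continuous.
    apply: (@cvg_comp _ _ _ snd fst); first exact: cvg_snd.
    exact: hsum_fst_continuous.
  have c2 : continuous (fun p : hsum H K * hsum H K => (p.1.2, p.2.2) : K * K).
    move=> p; apply: cvg_pair => /=.
      apply: (@cvg_comp _ _ _ fst snd); first exact: cvg_fst.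
      exact: hsum_snd_continuous.
    apply: (@cvg_comp _ _ _ snd snd); first exact: cvg_snd.
    exact: hsum_snd_continuous.
  apply: closedI.
    by apply: (@preimage_closed _ _ _ (graph A)) => // p _; exact: c1.
  by apply: (@preimage_closed _ _ _ (graph B)) => // p _; exact: c2.
move=> O [x Ox] oO.
have /nbhs_ballP[e /= e0 xO] : nbhs x O by exact: open_nbhs_nbhs.
have e20 : 0 < e / 2 by rewrite divr_gt0.
have near_dom (L : hilbertType R) (C : operator L) z : dense (domain C) ->
    exists2 u, domain C u & `|z - u| < e / 2.
  move=> /(_ (ball z (e / 2))) [].
  - by exists z; exact: ballxx.
  - exact: ball_open.
  - by move=> u [zu Cu]; exists u; move: zu; rewrite -?ball_normE.
have [a [c Aac] xa] := near_dom _ _ x.1 dA.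
have [b [d Bbd] xb] := near_dom _ _ x.2 dB.
exists ((a, b) : hsum H K); split; last by exists ((c, d) : hsum H K).
apply: xO; rewrite -ball_normE /= /ball_/= [e]splitr.
by apply: le_lt_trans (hsum_norm_le _) _; exact: ltrD.
Qed.

(* The projection theorem provides exactly one such y; the default value 0 is
   never used. *)
Definition proj (H : hilbertType R) (E : csubspace H) (x : H) : H :=
  xget 0 [set y | csub_set E y /\ forall z, csub_set E z -> inner (x - y) z = 0].

Definition unitary (H K : hilbertType R) (U : {linear H -> K}) :=
  (forall x y, inner (U x) (U y) = inner x y) /\ (forall z, exists x, U x = z).

End Operators.

Section Tuples.
Context {R : realType} {N : nat}.

Record optuple := OpTuple {
  space : hilbertType R ;
  op :> 'I_N -> operator space
}.

Record cdd_tuple := CDDTuple {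
  cdd_op :> optuple ;
  cdd_opP : forall j, closed_densely_defined (cdd_op j)
}.

Definition is_trivial (A : optuple) := forall x : space A, x = 0.

Definition restr (A : optuple) (E : csubspace (space A)) : optuple :=
  OpTuple (fun j => restr_op (A j) E).
Arguments restr : clear implicits.

Definition sum_tuple (A B : optuple) : optuple :=
  OpTuple (fun j => sum_op (A j) (B j)).

Definition cdd_sum (A B : cdd_tuple) : cdd_tuple :=
  @CDDTuple (sum_tuple A B) (fun j => sum_cdd (cdd_opP A j) (cdd_opP B j)).

(* The two sets are the graphs of P_E A_j and of A_j P_E. *)
Definition red (A : optuple) : set (csubspace (space A)) :=
  [set E | forall j,
     [set p | exists2 z, graph (A j) (p.1, z) & p.2 = proj E z] `<=`
     [set p | graph (A j) (proj E p.1, p.2)]].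
Arguments red : clear implicits.

Definition cred (A : optuple) : set (csubspace (space A)) :=
  [set E | red A E /\
     forall K, red A K -> forall x, proj E (proj K x) = proj K (proj E x)].
Arguments cred : clear implicits.

(* A_j = U^-1 B_j U: as U is bijective, y = U^-1 (B_j (U x)) is
   written U y = B_j (U x). *)
Definition ueq (A B : optuple) :=
  exists2 U : {linear space A -> space B}, unitary U &
    forall j x y, graph (A j) (x, y) <-> graph (B j) (U x, U y).

Record ucdd := UCDD {
  members : cdd_tuple -> Prop ;
  membersP : exists A : cdd_tuple, forall B, members B <-> ueq A B
}.

Definition uclass (A : cdd_tuple) : ucdd :=
  @UCDD (fun B => ueq A B) (ex_intro _ A (fun B => iff_refl _)).

Definition urepr (X : ucdd) : cdd_tuple := projT1 (cid (membersP X)).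

Definition usum (X Y : ucdd) : ucdd := uclass (cdd_sum (urepr X) (urepr Y)).

(* X is the class of the trivial tuples. *)
Definition is_zero (X : ucdd) := forall A, members X A <-> is_trivial A.

(* [ule] is the order <=, [sle] is the strong order <=^s. *)
Definition ule (X Y : ucdd) :=
  exists A B : cdd_tuple, [/\ members X A, members Y B &
    exists2 E, red B E & ueq A (restr B E)].

Definition sle (X Y : ucdd) :=
  exists A B : cdd_tuple, [/\ members X A, members Y B &
    exists2 E, cred B E & ueq A (restr B E)].

Definition uperp (X Y : ucdd) :=
  ~ exists Z : ucdd, [/\ ~ is_zero Z, ule Z X & ule Z Y].

(* Z is the boxed sum of X and Y: their direct sum, together with the
   information that X and Y are unitarily disjoint. *)
Definition is_boxplus (Z X Y : ucdd) := Z = usum X Y /\ uperp X Y.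

End Tuples.
Arguments optuple : clear implicits.
Arguments cdd_tuple : clear implicits.
Arguments ucdd : clear implicits.

Section Bounds.
Context {T : Type} (le : T -> T -> Prop).

Definition is_ub (S : T -> Prop) (x : T) := forall y, S y -> le y x.
Definition is_lb (S : T -> Prop) (x : T) := forall y, S y -> le x y.
Definition is_lub (S : T -> Prop) (x : T) :=
  is_ub S x /\ forall y, is_ub S y -> le x y.
Definition is_glb (S : T -> Prop) (x : T) :=
  is_lb S x /\ forall y, is_lb S y -> le y x.
Definition ub_bounded (S : T -> Prop) := exists x, is_ub S x.

End Bounds.

Definition pair_set (T : Type) (x y : T) : T -> Prop := fun z => z = x \/ z = y.

(* [ucdd R N] is a proper class. Its sets are the subclasses indexed by a type
   of the universe of the carriers of the Hilbert spaces. *)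
Definition is_set (T : Type) (S : T -> Prop) :=
  exists (I : Type@{Hilbert.axioms_.u0}) (F : I -> T),
    forall x, S x <-> exists i, F i = x.

(* Main.v *)
From HB Require Import structures.
From mathcomp Require Import all_boot all_order all_algebra sesquilinear ring lra.
From mathcomp Require Import complex finmap.
From mathcomp Require Import all_classical wochoice reals topology normedtype.
Require Import Defs.
Set Implicit Arguments. Unset Strict Implicit. Unset Printing Implicit Defensive.
Import Order.TTheory GRing.Theory Num.Theory Num.Def.
Import numFieldNormedType.Exports.
Local Open Scope classical_set_scope.
Local Open Scope ring_scope.
Local Open Scope complex_scope.

(** Everything is read off from intertwiners. An intertwiner T : A -> B is an
adjointable map of the underlying spaces such that T and its adjoint carry
the graph of each A j into that of B j and back. Unitary equivalence is a
unitary intertwiner, A <= B means that there is an isometric intertwiner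
V : A -> B ([uleP]), and A <=^s B means in addition that the range projection
V (adj V) commutes with every intertwiner B -> B ([sleP]); such a V is called
central. The point behind the last equivalence is [credP]: if the projection
P on a reducing subspace has a corner T' = (1 - P) T P different from 0, then
the graph of T' is a reducing subspace whose projection does not commute
with P. A central subspace and its orthogonal complement are therefore joined
by no intertwiner but 0 ([central_hom0]).

The heart of the proof is one construction that serves (A), (B) and (C). Let
(X_a) be a family, indexed by a well-ordered set. The fresh part X'_a of X_a
consists of the vectors killed by all intertwiners from X_a to an earlier X_b.
There is no intertwiner but 0 between two fresh parts, so whenever each X_a
embeds in Y, the images of the X'_a in Y are orthogonal, and the Hilbert sum S
of the fresh parts embeds in Y too, centrally if the given embeddings are
central ([fresh_sum_univ]). If the X_a are pairwise bounded for <=^s, then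
conversely each X_a embeds centrally in S ([fresh_sum_embed]): inside a common
bound of X_a and X_b the fresh part X'_b meets X_a in a central piece, and
transfinite induction shows that these pieces fill up X_a. So S is then the
least upper bound of the family for both orders.

(B) This applies to the set BB. For the infimum, the least upper bound J turns
the members of BB into central subspaces of J, whose intersection is the
greatest lower bound for both orders: if X embeds in J and in a central part
of J, then the copy of X in J lies inside that part ([isometric_sub_central]).
The latter also gives (D). Bounds are unique because both orders are
antisymmetric, which is a Cantor-Bernstein theorem ([cantor_bernstein]).

(A) Apply the construction to those central parts of one member of BB which
are strongly below all the members of BB; they are pairwise bounded by it.

(C) That (i) implies (ii) is the construction for a family of two. If A and B
sit centrally in C, with embeddings V and W, then T = (adj W) V : A -> B is a
partial isometry; its initial space is the common part of A and B, and the
kernels of T and of its adjoint are the other two summands. Conversely, A and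
B are summands of E + X + Y, and one must see that disjointness makes them
central: the polar decomposition shows that disjoint tuples are joined by no
contractive intertwiner but 0 ([schur]), and the off-diagonal corners of
projections are contractive.

Two devices keep the analysis short. Closed subspaces are built as equalizers
of intertwiners, and these are automatically reducing ([equalizer_red]). Partial
isometries with prescribed values are built from the projection on the
orthogonal complement of an equalizer in A + B ([pairing]); this replaces all
extensions by continuity, both in the polar decomposition and in gluing. *)

(** * Hilbert spaces: completeness, projections and density *)

Section Basics.
Context {R : realType} {H : hilbertType R}.
Implicit Types (x y z : H) (a : R[i]).

Lemma innerDl x y z : inner (x + y) z = inner x z + inner y z.
Proof. by rewrite linearDl. Qed.
Lemma innerBl x y z : inner (x - y) z = inner x z - inner y z.
Proof. by rewrite linearBl. Qed.
Lemma innerZl a x z : inner (a *: x) z = a * inner x z.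
Proof. by rewrite linearZl_LR. Qed.
Lemma innerDr x y z : inner z (x + y) = inner z x + inner z y.
Proof. by rewrite linearDr. Qed.
Lemma innerBr x y z : inner z (x - y) = inner z x - inner z y.
Proof. by rewrite linearBr. Qed.
Lemma innerZr a x z : inner z (a *: x) = a^*%R * inner z x.
Proof. by rewrite linearZr_LR. Qed.
Lemma inner0l z : inner (0 : H) z = 0. Proof. by rewrite linear0l. Qed.
Lemma inner0r z : inner z (0 : H) = 0. Proof. by rewrite linear0r. Qed.
Lemma innerC x y : inner x y = (inner y x)^*%R.
Proof. by rewrite hermC /= mul1r. Qed.

Lemma inner_eq0C x y : inner x y = 0 -> inner y x = 0.
Proof. by move=> xy; rewrite innerC xy conjC0. Qed.

Lemma inner_self_eq0 x : inner x x = 0 -> x = 0.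
Proof. by move/eqP; rewrite dnorm_eq0 => /eqP. Qed.

Lemma inner_ext x y : (forall z, inner x z = inner y z) -> x = y.
Proof.
move=> xy; apply/eqP; rewrite -subr_eq0; apply/eqP/inner_self_eq0.
by rewrite innerBl xy subrr.
Qed.

Definition nrm x : R := complex.Re `|x|.

Lemma nrmE x : `|x| = (nrm x)%:C.
Proof. by rewrite RRe_real ?ger0_real. Qed.

Lemma nrm_ge0 x : 0 <= nrm x.
Proof. by rewrite -ler0c -nrmE. Qed.

Lemma inner_nrm x : inner x x = (nrm x ^+ 2)%:C.
Proof. by rewrite inner_norm nrmE rmorphXn. Qed.

Lemma nrmD x y : nrm (x + y) <= nrm x + nrm y.
Proof. by rewrite -lecR rmorphD /= -!nrmE ler_normD. Qed.

Lemma nrmB x y : nrm (x - y) = nrm (y - x).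
Proof. by rewrite /nrm distrC. Qed.

Lemma nrm_eq0 x : nrm x = 0 -> x = 0.
Proof. by move=> x0; apply/eqP; rewrite -normr_eq0 nrmE x0. Qed.

Lemma nrm0 : nrm 0 = 0.
Proof. by rewrite /nrm normr0. Qed.

Lemma nrmZ (a : R) x : nrm (a%:C *: x) = `|a| * nrm x.
Proof.
apply: complexI; rewrite -nrmE normrZ nrmE rmorphM; congr (_ * _).
by rewrite normc_def /= expr0n /= addr0 sqrtr_sqr.
Qed.

Lemma nrm_le0 x : (forall e : R, 0 < e -> nrm x <= e) -> x = 0.
Proof.
move=> x0; apply: nrm_eq0; apply/eqP; rewrite eq_le nrm_ge0 andbT.
apply/ler_addgt0Pr => e e0; rewrite add0r; exact: x0.
Qed.

Lemma sqr_nrmD x y :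
  nrm (x + y) ^+ 2 = nrm x ^+ 2 + nrm y ^+ 2 + 2 * complex.Re (inner x y).
Proof.
apply: complexI; rewrite -inner_nrm innerDl !innerDr (innerC y x) !inner_nrm.
by case: (inner x y) => p q; simpc; apply/eqP; rewrite eq_complex /=; apply/andP;
  split; apply/eqP; ring.
Qed.

Lemma sqr_nrmB x y :
  nrm (x - y) ^+ 2 = nrm x ^+ 2 + nrm y ^+ 2 - 2 * complex.Re (inner x y).
Proof.
have -> : nrm (x - y) = nrm (x + (-1) *: y) by rewrite scaleN1r.
rewrite sqr_nrmD innerZr (_ : nrm (-1 *: y) = nrm y); last first.
  by rewrite /nrm scaleN1r normrN.
by rewrite rmorphN rmorph1 mulN1r raddfN mulrN.
Qed.

(** The Cauchy-Schwarz inequality, from the positivity of the squared norm of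
[<y, y> x - <x, y> y]. *)
Lemma inner_bound x y : `|inner x y| <= (nrm x * nrm y)%:C.
Proof.
have [->|y0] := eqVneq y 0; first by rewrite inner0r normr0 ler0c mulr_ge0 ?nrm_ge0.
have n0 : 0 < inner y y by rewrite neq0_dnorm_gt0.
rewrite -ler_sqr ?nnegrE ?normr_ge0// ?ler0c ?mulr_ge0 ?nrm_ge0//.
have -> : (nrm x * nrm y)%:C ^+ 2 = inner x x * inner y y.
  by rewrite !inner_nrm -rmorphM -rmorphXn exprMn.
rewrite normCK -subr_ge0.
have : 0 <= inner (inner y y *: x - inner x y *: y) (inner y y *: x - inner x y *: y).
  by rewrite dnorm_ge0.
rewrite innerBl !innerBr !innerZl !innerZr (innerC y x) -(innerC y y).
set n := inner y y; set p := inner x y; set q := p^*%R; set X := inner x x.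
rewrite (_ : _ - _ = n * (X * n - p * q)); last by ring.
by rewrite pmulr_rge0.
Qed.

Lemma realeps (e : R[i]) : 0 < e -> exists2 r : R, 0 < r & e = r%:C.
Proof.
move=> e0; exists (complex.Re e); last by rewrite RRe_real ?gtr0_real.
by rewrite -ltcR RRe_real ?gtr0_real.
Qed.

Lemma complete_seq (u : nat -> H) :
  (forall e : R, 0 < e -> exists n, forall m, (n <= m)%N -> nrm (u n - u m) < e) ->
  exists l, forall e : R, 0 < e -> exists n, forall m, (n <= m)%N -> nrm (l - u m) < e.
Proof.
move=> uC.
have : cvg (u @ \oo).
  apply: cauchy_cvg; apply: cauchy_exP => e /realeps[r r0 ->].
  have [n un] := uC _ r0; exists (u n); exists n => // m /= nm.
  by rewrite -ball_normE /= /ball_ nrmE ltcR un.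
move=> /cvg_ex[l ul]; exists l => e e0.
move/cvgrPdist_lt: ul => /(_ e%:C); rewrite ltcR => /(_ e0)[n _ un].
by exists n => m nm; have := un m nm; rewrite /= nrmE ltcR.
Qed.

Lemma nbhs_nrm x (B : set H) :
  nbhs x B <-> exists2 e : R, 0 < e & forall y, nrm (x - y) < e -> B y.
Proof.
split=> [/nbhs_ballP[e /= /realeps[r r0 ->] rB]|[e e0 eB]].
  by exists r => // y xy; apply: rB; rewrite -ball_normE /= nrmE ltcR.
apply/nbhs_ballP; exists e%:C; first by rewrite /= ltcR.
by move=> y; rewrite -ball_normE /= nrmE ltcR; exact: eB.
Qed.

Lemma closed_nrm (S : set H) :
  closed S <-> forall x, (forall e : R, 0 < e -> exists2 y, S y & nrm (x - y) < e) -> S x.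
Proof.
split=> [cS x Sx|Sx x xS].
  apply: cS => B /nbhs_nrm[e e0 eB].
  by have [y Sy xy] := Sx e e0; exists y; split=> //; exact: eB.
apply: Sx => e e0.
have /xS[y [Sy]] : nbhs x [set y | nrm (x - y) < e] by apply/nbhs_nrm; exists e.
by exists y.
Qed.

Lemma dense_nrm (S : set H) :
  dense S <-> forall x e, 0 < e -> exists2 y, S y & nrm (x - y) < e.
Proof.
split=> [dS x e e0|Sx O [x Ox] oO].
  have e0' : 0 < e%:C by rewrite ltcR.
  have [y [xy Sy]] := dS (ball x e%:C) (ex_intro _ x (ballxx _ e0')) (ball_open _ _).
  by exists y => //; move: xy; rewrite -ball_normE /= nrmE ltcR.
have /nbhs_nrm[e e0 eO] : nbhs x O by exact: open_nbhs_nbhs.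
by have [y Sy /eO Oy] := Sx x e e0; exists y.
Qed.

(** Equalizers are built as annihilators, which are closed submodules by
construction. *)
Definition perp (S : set H) : set H := [set x | forall z, S z -> inner x z = 0].

Lemma perp_submod S : submod_closed [in perp S].
Proof.
split; first by rewrite inE => z _; rewrite inner0l.
move=> a x y; rewrite !inE => Sx Sy z Sz.
by rewrite innerDl innerZl Sx// Sy// mulr0 addr0.
Qed.

Lemma inner_eq0_lim (p z : H) :
  (forall e : R, 0 < e -> exists2 q, inner q z = 0 & nrm (p - q) < e) -> inner p z = 0.
Proof.
move=> pz; apply/eqP; rewrite -normr_eq0.
have [->|z0] := eqVneq z 0; first by rewrite inner0r normr0.
have zn : 0 < nrm z.
  by rewrite lt_def nrm_ge0 andbT; apply: contra_neq z0 => /nrm_eq0.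
have /complex_realP[r pr] : `|inner p z| \is Num.real by rewrite ger0_real.
have r0 : 0 <= r by rewrite -ler0c -pr.
rewrite pr (_ : r = 0)//; apply/le_anti; rewrite r0 andbT.
apply/ler_addgt0Pr => e e0.
have [q qz pq] := pz (e / nrm z) (divr_gt0 e0 zn).
rewrite add0r -lecR -pr; have := inner_bound (p - q) z.
rewrite innerBl qz subr0 => /le_trans; apply; rewrite lecR.
by rewrite -ler_pdivlMr// ltW.
Qed.

Lemma perp_closed S : closed (perp S).
Proof.
apply/closed_nrm => x xS z Sz; apply: inner_eq0_lim => e /xS[y yS xy].
by exists y => //; exact: yS.
Qed.

Definition perp_csub S := CSubspace (perp_submod S) (perp_closed (S := S)).

Lemma csub0 (E : csubspace H) : csub_set E 0.
Proof. by have [+ _] := csub_submod E; rewrite inE. Qed.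

Lemma csub_lin (E : csubspace H) a x y :
  csub_set E x -> csub_set E y -> csub_set E (a *: x + y).
Proof. by have [_ /(_ a x y)] := csub_submod E; rewrite !inE => h Ex Ey; exact: h. Qed.

Lemma csubZ (E : csubspace H) a x : csub_set E x -> csub_set E (a *: x).
Proof. by move=> Ex; rewrite -[_ *: _]addr0; apply: csub_lin => //; exact: csub0. Qed.

Lemma csubD (E : csubspace H) x y : csub_set E x -> csub_set E y -> csub_set E (x + y).
Proof. by move=> Ex Ey; rewrite -[x]scale1r; exact: csub_lin. Qed.

Lemma csubB (E : csubspace H) x y : csub_set E x -> csub_set E y -> csub_set E (x - y).
Proof. by move=> Ex Ey; rewrite -scaleN1r addrC; exact: csub_lin. Qed.

Lemma exists_invS_lt (e : R) : 0 < e -> exists n, n.+1%:R^-1 < e.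
Proof.
move=> e0; exists (Num.bound e^-1).
rewrite invf_plt ?posrE//.
rewrite (lt_trans (archi_boundP _)) ?invr_ge0 ?ltW//.
by rewrite ltr_nat.
Qed.

Lemma invS_le (n m : nat) : (n <= m)%N -> m.+1%:R^-1 <= n.+1%:R^-1 :> R.
Proof. by move=> nm; rewrite lef_pV2 ?posrE// ler_nat. Qed.

(** If w is not made shorter by any move inside E, then in particular not by
subtracting its component along z, so that component vanishes. *)
Lemma nearest_orth (E : csubspace H) w :
  (forall v, csub_set E v -> nrm w <= nrm (w - v)) ->
  forall z, csub_set E z -> inner w z = 0.
Proof.
move=> wmin z Ez; have [->|z0] := eqVneq z 0; first by rewrite inner0r.
have n0 : 0 < inner z z by rewrite neq0_dnorm_gt0.
set p := inner w z.
have := wmin (p / inner z z *: z) (csubZ _ Ez).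
rewrite -ler_sqr ?nnegrE ?nrm_ge0// -lecR -!inner_nrm innerBl !innerBr !innerZl !innerZr.
rewrite (innerC z w) -/p -subr_ge0 fmorph_div /= -(innerC z z).
rewrite (_ : _ - _ = - (p * p^*%R / inner z z)); last by field; rewrite gt_eqF.
rewrite oppr_ge0 -normCK => p0; apply/eqP; rewrite -normr_eq0 -sqrf_eq0.
rewrite eq_le exprn_ge0// andbT -(pmulr_lle0 _ (x := (inner z z)^-1)) ?invr_gt0//.
Qed.

(** Points of E at nearly minimal distance from x form a Cauchy sequence by the
parallelogram law; the limit is a nearest point, so [nearest_orth] applies. *)
Theorem proj_exists (E : csubspace H) x :
  exists y, csub_set E y /\ forall z, csub_set E z -> inner (x - y) z = 0.
Proof.
pose D := [set nrm (x - y) ^+ 2 | y in csub_set E]; pose d := inf D.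
have hD : has_inf D.
  split; first by exists (nrm (x - 0) ^+ 2); exists 0 => //; exact: csub0.
  by exists 0 => _ [y _ <-]; rewrite exprn_ge0 ?nrm_ge0.
have dmin y : csub_set E y -> d <= nrm (x - y) ^+ 2.
  by move=> Ey; apply: ge_inf; [exact: hD.2|exists y].
have /choice[u uP] n : exists y, csub_set E y /\ nrm (x - y) ^+ 2 < d + n.+1%:R^-1.
  have [|_ [y Ey <-] yd] := inf_adherent _ hD (eps := n.+1%:R^-1); first by rewrite invr_gt0.
  by exists y.
have par y z : csub_set E y -> csub_set E z ->
    nrm (y - z) ^+ 2 <= 2 * (nrm (x - y) ^+ 2 - d) + 2 * (nrm (x - z) ^+ 2 - d).
  move=> Ey Ez.
  have := dmin (2^-1%:C *: (y + z)) (csubZ _ (csubD Ey Ez)).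
  have half (v : H) : v = 2^-1%:C *: (v + v).
    rewrite scalerDr -scalerDl -rmorphD /= (_ : 2^-1 + 2^-1 = 1) ?scale1r//.
    lra.
  have -> : x - 2^-1%:C *: (y + z) = 2^-1%:C *: ((x - y) + (x - z)).
    by rewrite addrACA -opprD scalerBr -half.
  have -> : y - z = (x - z) - (x - y) by rewrite opprB [RHS]addrC addrA subrK.
  move: (x - y) (x - z) => p q.
  rewrite nrmZ ger0_norm ?invr_ge0// exprMn sqr_nrmB sqr_nrmD (innerC q).
  have -> : complex.Re (inner p q)^*%R = complex.Re (inner p q) by case: (inner _ _).
  move: (nrm _ ^+ 2) (nrm _ ^+ 2) (complex.Re _) => a b c.
  by lra.
(* The squared distances are within 1 / (n + 1) of the infimum; 4 / (n + 1) < e^2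
   turns the parallelogram bound into a Cauchy estimate. *)
have [l ul] : exists l, forall e : R, 0 < e ->
    exists n, forall m, (n <= m)%N -> nrm (l - u m) < e.
  apply: complete_seq => e e0.
  have [n ne] := exists_invS_lt (divr_gt0 (exprn_gt0 2 e0) (ltr0n R 4)).
  exists n => m nm; rewrite -ltr_sqr ?nnegrE ?nrm_ge0 ?ltW//.
  have := par _ _ (uP n).1 (uP m).1; have := (uP n).2; have := (uP m).2.
  have := invS_le nm; move: ne.
  move: (nrm _ ^+ 2) (nrm _ ^+ 2) (nrm _ ^+ 2) (e ^+ 2) n.+1%:R^-1 m.+1%:R^-1 => a b c f p q.
  lra.
have El : csub_set E l.
  have /closed_nrm := @csub_closed _ _ E; apply => e /ul[n un].
  by exists (u n); [exact: (uP n).1|exact: un].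
exists l; split=> //; apply: nearest_orth => v Ev.
have -> : x - l - v = x - (l + v) by rewrite opprD addrA.
have {Ev} := csubD El Ev; move: (l + v) => {}v Ev.
apply/ler_addgt0Pr => e e0.
have e20 : 0 < e / 2 by rewrite divr_gt0.
have [n ne] := exists_invS_lt (exprn_gt0 2 e20); have [m lm] := ul _ e20.
set k := maxn n m.
have lk := lm k (leq_maxr _ _).
have : nrm (x - l) <= nrm (x - u k) + nrm (u k - l).
  by apply: le_trans (nrmD _ _); rewrite addrA subrK.
rewrite (nrmB (u k) l).
have : nrm (x - u k) <= nrm (x - v) + e / 2.
  rewrite -ler_sqr ?nnegrE ?addr_ge0 ?nrm_ge0 ?(ltW e20)//.
  have := (uP k).2; have := dmin v Ev; have := invS_le (leq_maxl n m); rewrite -/k.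
  have : 0 <= nrm (x - v) * (e / 2) by rewrite mulr_ge0 ?nrm_ge0 ?(ltW e20).
  move: ne; rewrite sqrrD.
  move: (_ ^+ 2) (_ * _) (_ ^+ 2) (_ ^+ 2) n.+1%:R^-1 k.+1%:R^-1 => a b c f p q.
  lra.
move: lk; lra.
Qed.

Lemma projP (E : csubspace H) x :
  csub_set E (proj E x) /\ forall z, csub_set E z -> inner (x - proj E x) z = 0.
Proof.
exact: (xgetPex 0 (proj_exists E x)).
Qed.

Lemma proj_eq (E : csubspace H) x y :
  csub_set E y -> (forall z, csub_set E z -> inner (x - y) z = 0) -> proj E x = y.
Proof.
move=> Ey xy; have [Ep xp] := projP E x.
apply/eqP; rewrite -subr_eq0; apply/eqP/inner_self_eq0.
have Ed := csubB Ep Ey; rewrite {1}(_ : _ - _ = (x - y) - (x - proj E x)).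
  by rewrite innerBl xy// xp// subrr.
by rewrite opprB [RHS]addrC addrA subrK.
Qed.

Lemma proj_id (E : csubspace H) x : csub_set E x -> proj E x = x.
Proof. by move=> Ex; apply: proj_eq => // z _; rewrite subrr inner0l. Qed.

Lemma proj_in (E : csubspace H) x : csub_set E (proj E x).
Proof. exact: (projP E x).1. Qed.

Lemma proj_adj (E : csubspace H) x y : inner (proj E x) y = inner x (proj E y).
Proof.
have [Ex xP] := projP E x; have [Ey yP] := projP E y.
transitivity (inner (proj E x) (proj E y)).
  by apply/eqP; rewrite -subr_eq0 -innerBr; apply/eqP/inner_eq0C/yP.
by apply/esym/eqP; rewrite -subr_eq0 -innerBl; apply/eqP/xP.
Qed.

(** The projection of x on the closure of S differs from x by a vector orthogonal
to S. *)
Lemma submod_dense (S : set H) : submod_closed [in S] ->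
  (forall x, (forall y, S y -> inner x y = 0) -> x = 0) -> dense S.
Proof.
move=> sS S0.
have cP : submod_closed [in closure S].
  have [s0 sP] := sS; split; first by rewrite inE; apply: subset_closure; move: s0; rewrite inE.
  move=> a x y; rewrite !inE => Sx Sy B /nbhs_nrm[e e0 eB].
  pose b := complex.Re `|a|.
  have ab : `|a| = b%:C by rewrite RRe_real ?ger0_real.
  have b0 : 0 <= b by rewrite -ler0c -ab.
  have b1 : 0 < 2 * (b + 1) by lra.
  have app (v : H) (r : R) : closure S v -> 0 < r -> exists2 w, S w & nrm (v - w) < r.
    move=> Sv r0; have /Sv[w [Sw vw]] : nbhs v [set w | nrm (v - w) < r].
      by apply/nbhs_nrm; exists r.
    by exists w.
  have [x' Sx' xx'] := app x _ Sx (divr_gt0 e0 b1).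
  have [y' Sy' yy'] := app y _ Sy (divr_gt0 e0 (ltr0n R 2)).
  exists (a *: x' + y'); split; first by have := sP a x' y'; rewrite !inE; exact.
  apply: eB; rewrite opprD addrACA -scalerBr.
  apply: (le_lt_trans (nrmD _ _)).
  have -> : nrm (a *: (x - x')) = b * nrm (x - x').
    by apply: complexI; rewrite -nrmE normrZ nrmE rmorphM ab.
  have : b * nrm (x - x') <= b * (e / (2 * (b + 1))) by rewrite ler_wpM2l// ltW.
  have : b * (e / (2 * (b + 1))) <= e / 2.
    by rewrite mulrA ler_pdivrMr// mulrA divfK ?pnatr_eq0// mulrC ler_wpM2l ?ltW// ltrDl.
  move: yy'; rewrite /=; lra.
pose E := CSubspace cP (@closed_closure _ S).
apply/dense_nrm => x e e0.
have Ex : proj E x = x.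
  apply/esym/eqP; rewrite -subr_eq0; apply/eqP/S0 => y Sy.
  by apply: (projP E x).2; exact: subset_closure.
have : closure S x by rewrite -Ex; exact: (proj_in E).
move=> /(_ [set y | nrm (x - y) < e])[|y [Sy xy]]; first by apply/nbhs_nrm; exists e.
by exists y.
Qed.

Lemma dense_perp (S : set H) : dense S -> forall x, (forall y, S y -> inner x y = 0) -> x = 0.
Proof.
move=> /dense_nrm dS x xS; apply: inner_self_eq0; apply: inner_eq0C.
apply: inner_eq0_lim => e /(dS x)[y Sy xy].
by exists y => //; apply: inner_eq0C; exact: xS.
Qed.
End Basics.

(** * Intertwiners, equalizers and restrictions *)

Section Products.
Context {R : realType} (H K : hilbertType R).

Lemma closed_prod_nrm (G : set (H * K)) :
  closed G <-> forall x y, (forall e : R, 0 < e -> exists x' y',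
    [/\ G (x', y'), nrm (x - x') < e & nrm (y - y') < e]) -> G (x, y).
Proof.
split=> [cG x y xyG|GP [x y] xyG].
  apply: cG => B [[B1 B2] /= [/nbhs_nrm[e1 e10 eB1] /nbhs_nrm[e2 e20 eB2]] BB].
  have [|x' [y' [Gxy xx' yy']]] := xyG (Num.min e1 e2); first by rewrite lt_min e10.
  move: xx' yy'; rewrite !lt_min => /andP[xx' _] /andP[_ yy'].
  by exists (x', y'); split=> //; apply: BB; split; [exact: eB1|exact: eB2].
apply: GP => e e0.
have /xyG[[x' y'] [Gxy [/= xx' yy']]] :
    nbhs (x, y) [set p | nrm (x - p.1) < e /\ nrm (y - p.2) < e].
  exists ([set u | nrm (x - u) < e], [set v | nrm (y - v) < e]) => //=.
  by split; apply/nbhs_nrm; exists e.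
by exists x', y'.
Qed.

Lemma inner_hsum (u v : hsum H K) : inner u v = inner u.1 v.1 + inner u.2 v.2.
Proof. by []. Qed.

Lemma sqr_nrm_hsum (u : hsum H K) : nrm u ^+ 2 = nrm u.1 ^+ 2 + nrm u.2 ^+ 2.
Proof. by apply: complexI; rewrite rmorphD /= -!inner_nrm inner_hsum. Qed.

Lemma nrm_fst (u : hsum H K) : nrm u.1 <= nrm u.
Proof. by rewrite -ler_sqr ?nnegrE ?nrm_ge0// sqr_nrm_hsum lerDl exprn_ge0 ?nrm_ge0. Qed.

Lemma nrm_snd (u : hsum H K) : nrm u.2 <= nrm u.
Proof. by rewrite -ler_sqr ?nnegrE ?nrm_ge0// sqr_nrm_hsum lerDr exprn_ge0 ?nrm_ge0. Qed.

Lemma closed_hsum (G : set (H * K)) : closed G -> closed (G : set (hsum H K)).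
Proof.
move=> /closed_prod_nrm GP; apply/closed_nrm => -[x y] xyG; apply: GP => e /xyG[[x' y'] Gxy xy].
exists x', y'; split=> //.
  exact: le_lt_trans (nrm_fst ((x, y) - (x', y') : hsum H K)) xy.
exact: le_lt_trans (nrm_snd ((x, y) - (x', y') : hsum H K)) xy.
Qed.
End Products.

Section GraphProjection.
Context {R : realType} {H : hilbertType R} (A : operator H).

Lemma graph_submod_hsum : submod_closed [in (graph A : set (hsum H H))].
Proof.
have [A0 AD] := graph_submod A.
by split=> [|a u v]; [exact: A0|exact: AD].
Qed.

Lemma graph0 : graph A (0, 0).
Proof. by have [+ _] := graph_submod A; rewrite inE. Qed.

Lemma graph_lin a x y x' y' :
  graph A (x, y) -> graph A (x', y') -> graph A (a *: x + x', a *: y + y').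
Proof.
by move=> xy xy'; have [_ /(_ a (x, y) (x', y'))] := graph_submod A; rewrite !inE; apply.
Qed.

Lemma domain_submod : submod_closed [in domain A].
Proof.
split; first by rewrite inE; exists 0; exact: graph0.
move=> a x x'; rewrite !inE => -[y xy] [y' xy'].
by exists (a *: y + y'); exact: graph_lin.
Qed.

Hypothesis cA : closed (graph A).

(** Passing from the product to the Hilbert space [hsum] makes the orthogonal
projection on the graph available. *)
Definition graph_csub : csubspace (hsum H H) :=
  CSubspace graph_submod_hsum (closed_hsum cA).
End GraphProjection.

Section Homs.
Context {R : realType} {N : nat}.
Implicit Types A B C : optuple R N.

(** A map with an adjoint is linear, so only the adjunction and the invariance of
the graphs are recorded; both are symmetric in the two maps, hence [adj]. *)
Record hom A B := Hom {
  fw :> space A -> space B ;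
  bw : space B -> space A ;
  homE : forall x y, inner (fw x) y = inner x (bw y) ;
  fw_graph : forall j x y, graph (A j) (x, y) -> graph (B j) (fw x, fw y) ;
  bw_graph : forall j x y, graph (B j) (x, y) -> graph (A j) (bw x, bw y)
}.

Lemma homE' A B (T : hom A B) x y : inner (bw T x) y = inner x (T y).
Proof. by rewrite innerC -homE -innerC. Qed.

Definition adj A B (T : hom A B) : hom B A :=
  Hom (homE' T) (@bw_graph _ _ T) (@fw_graph _ _ T).

Lemma adjE A B (T : hom A B) x y : inner (T x) y = inner x (adj T y).
Proof. exact: homE. Qed.

Lemma adjE' A B (T : hom A B) x y : inner (adj T x) y = inner x (T y).
Proof. exact: homE'. Qed.

Lemma adjK A B (T : hom A B) : adj (adj T) =1 T.
Proof. by []. Qed.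

Lemma hom_lin A B (T : hom A B) a x y : T (a *: x + y) = a *: T x + T y.
Proof. by apply: inner_ext => z; rewrite homE !innerDl !innerZl !homE. Qed.

Lemma hom0 A B (T : hom A B) : T 0 = 0.
Proof. by apply: inner_ext => z; rewrite homE !inner0l. Qed.

Lemma homD A B (T : hom A B) x y : T (x + y) = T x + T y.
Proof. by rewrite -[x]scale1r hom_lin !scale1r. Qed.

Lemma homB A B (T : hom A B) x y : T (x - y) = T x - T y.
Proof. by apply: inner_ext => z; rewrite homE !innerBl !homE. Qed.

Definition hid A : hom A A := @Hom A A id id (fun _ _ => erefl)
  (fun _ _ _ => id) (fun _ _ _ => id).

Program Definition hcomp A B C (T : hom B C) (S : hom A B) : hom A C :=
  @Hom A C (T \o S) (bw S \o bw T) _ _ _.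
Next Obligation. by move=> A B C T S x y /=; rewrite !homE. Qed.
Next Obligation. by move=> A B C T S j x y xy /=; do 2 apply: fw_graph. Qed.
Next Obligation. by move=> A B C T S j x y xy /=; do 2 apply: bw_graph. Qed.

Program Definition hzero A B : hom A B := @Hom A B (fun=> 0) (fun=> 0) _ _ _.
Next Obligation. by move=> A B x y /=; rewrite inner0l inner0r. Qed.
Next Obligation. by move=> A B j x y _; exact: graph0. Qed.
Next Obligation. by move=> A B j x y _; exact: graph0. Qed.

Program Definition hlincomb A B (a : R) (T S : hom A B) : hom A B :=
  @Hom A B (fun x => a%:C *: T x + S x) (fun x => a%:C *: bw T x + bw S x) _ _ _.
Next Obligation.
move=> A B a T S x y /=; rewrite innerDl innerDr innerZl innerZr !homE.
by congr (_ * _ + _); rewrite /conjC /= oppr0.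
Qed.
Next Obligation. by move=> A B a T S j x y xy; apply: graph_lin; exact: fw_graph. Qed.
Next Obligation. by move=> A B a T S j x y xy; apply: graph_lin; exact: bw_graph. Qed.

Lemma hcompE A B C (T : hom B C) (S : hom A B) x : hcomp T S x = T (S x).
Proof. by []. Qed.

Lemma adj_hcompE A B C (T : hom B C) (S : hom A B) x :
  adj (hcomp T S) x = adj S (adj T x).
Proof. by []. Qed.
End Homs.
Arguments adj : simpl never.
Arguments hcomp : simpl never.
Arguments hlincomb : simpl never.

Section Equalizer.
Context {R : realType} {N : nat}.
Implicit Types A B C : cdd_tuple R N.

Definition gcsub A j := graph_csub (cdd_opP A j).1.

(** The diagonal map of T sends the graph of A j to that of B j, and the orthogonal
complement of the former to that of the latter, because the adjoint maps the
graphs backwards. Thus T intertwines bounded operators, the entries of the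
graph projections. *)
Lemma gproj_hom A B (T : hom A B) j (u : hsum (space A) (space A)) :
  proj (gcsub B j) ((T u.1, T u.2) : hsum _ _) =
  ((T (proj (gcsub A j) u).1, T (proj (gcsub A j) u).2) : hsum _ _).
Proof.
have [Gp up] := projP (gcsub A j) u.
apply: proj_eq; first by apply: fw_graph; move: Gp; case: (proj _ _).
move=> [z1 z2] Bz; rewrite inner_hsum /= -!homB !homE.
by apply: (up ((bw T z1, bw T z2) : hsum _ _)); exact: bw_graph.
Qed.

Variables (A : cdd_tuple R N) (I : Type) (B : I -> cdd_tuple R N).
Variables (S T : forall i, hom A (B i)).

Definition equalizer : csubspace (space A) :=
  perp_csub [set w | exists i z, w = adj (S i) z - adj (T i) z].

Lemma equalizerP x : csub_set equalizer x <-> forall i, S i x = T i x.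
Proof.
split=> [Ex i|ST _ [i [z ->]]]; last by rewrite innerBr -!adjE ST subrr.
apply: inner_ext => z; apply/eqP; rewrite -subr_eq0 !adjE -innerBr; apply/eqP/Ex.
by exists i, z.
Qed.

(** By [gproj_hom], the projection on the graph of A j maps the square of the
equalizer into itself; two orthogonal projections one of which preserves the
range of the other commute, so the projection on the square of the equalizer
preserves the graph. *)
Lemma equalizer_red : red equalizer.
Proof.
move=> j [x _] [y /= xy ->] /=.
pose P := proj equalizer; pose u := ((P x, P y) : hsum (space A) (space A)).
pose v := proj (gcsub A j) u.
(* The graph projection of a pair in the equalizer stays in the equalizer. *)
have Ev : csub_set equalizer v.1 /\ csub_set equalizer v.2.
  have := fun i => gproj_hom (S i) j u; have := fun i => gproj_hom (T i) j u.
  rewrite -/v => vT vS; split; apply/equalizerP => i; move: (vS i) (vT i);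
    have /equalizerP/(_ i) <- := proj_in equalizer x;
    have /equalizerP/(_ i) <- := proj_in equalizer y;
    by move=> -> [].
suff -> : (P x, P y) = v by exact: (proj_in (gcsub A j) u).
have [Gv uv] := projP (gcsub A j) u.
apply/eqP; rewrite -subr_eq0 -/u; apply/eqP/(@inner_self_eq0 _ (hsum _ _)).
have EPx : csub_set equalizer (P x - v.1) by apply: csubB Ev.1; exact: proj_in.
have EPy : csub_set equalizer (P y - v.2) by apply: csubB Ev.2; exact: proj_in.
rewrite [LHS](@innerBl _ (hsum _ _)).
have -> : inner v (u - v) = 0 by apply: inner_eq0C; exact: uv.
have -> : inner u (u - v) = inner ((x, y) : hsum (space A) (space A)) (u - v).
  by rewrite !inner_hsum /= !proj_adj !proj_id.
by rewrite subr0; apply: inner_eq0C; exact: (uv ((x, y) : hsum _ _)).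
Qed.
End Equalizer.

Section Restriction.
Context {R : realType} {N : nat}.
Implicit Types A B C : cdd_tuple R N.

Lemma redP A (E : csubspace (space A)) : red E <->
  forall j x y, graph (A j) (x, y) -> graph (A j) (proj E x, proj E y).
Proof.
split=> [rE j x y xy|rE j [x w] [y /= xy] ->]; last exact: rE.
by apply: (rE j (x, proj E y)); exists y.
Qed.

Definition csub_proj (H : hilbertType R) (E : csubspace H) (x : H) : csub_type E :=
  CSubType (mem_set (proj_in E x) : proj E x \in csub_pred E).

Lemma csub_valK (H : hilbertType R) (E : csubspace H) (x : csub_type E) :
  csub_set E (csub_val x).
Proof. by have := csub_valP x; rewrite inE. Qed.

Lemma csub_inner (H : hilbertType R) (E : csubspace H) (x y : csub_type E) :
  inner x y = inner (csub_val x) (csub_val y).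
Proof. by []. Qed.

Lemma csub_val_inj (H : hilbertType R) (E : csubspace H) : injective (@csub_val R H E).
Proof. exact: val_inj. Qed.

Section Sub.
Variables (A : cdd_tuple R N) (E : csubspace (space A)).
Hypothesis rE : red E.

Lemma restr_cddP j : closed_densely_defined (restr E j).
Proof.
have [cA dA] := cdd_opP A j; split.
  apply/closed_prod_nrm => x y xyE; rewrite /= /restr_graph /=.
  move/closed_prod_nrm: cA; apply => e /xyE[x' [y' [xy' xx' yy']]].
  by exists (csub_val x'), (csub_val y').
apply: submod_dense; first exact: (domain_submod (restr E j)).
move=> x xE; apply: csub_val_inj; apply: (dense_perp dA) => d [d' dd'].
have <- : proj E (csub_val x) = csub_val x by rewrite proj_id//; exact: csub_valK.
rewrite proj_adj; apply: (xE (csub_proj E d)).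
by exists (csub_proj E d'); move/redP: rE; exact.
Qed.

Definition sub_tuple : cdd_tuple R N := CDDTuple restr_cddP.

(** The adjoint of the inclusion is the projection; that it preserves the graphs is
exactly the condition that E reduces A. *)
Program Definition incl : hom sub_tuple A :=
  @Hom R N sub_tuple A (@csub_val R _ E) (csub_proj E) _ _ _.
Next Obligation.
by move=> x y; rewrite csub_inner /= -proj_adj proj_id//; exact: csub_valK.
Qed.
Next Obligation. by []. Qed.
Next Obligation. by move=> j x y xy; move/redP: rE; exact. Qed.

Lemma inclK x : adj incl (incl x) = x.
Proof. by apply: csub_val_inj; rewrite /= proj_id//; exact: csub_valK. Qed.

Lemma incl_adj x : incl (adj incl x) = proj E x.
Proof. by []. Qed.
End Sub.
End Restriction.

(** * Central embeddings and the two orders *)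

Section Central.
Context {R : realType} {N : nat}.
Implicit Types A B C X Y Z : cdd_tuple R N.

Definition isometric A B (V : hom A B) := forall x, adj V (V x) = x.

(** The range projection of V is central in the von Neumann algebra of
self-intertwiners of B. *)
Definition central A B (V : hom A B) :=
  isometric V /\ forall (T : hom B B) x, V (adj V (T x)) = T (V (adj V x)).

Definition unitary_hom A B (U : hom A B) := isometric U /\ isometric (adj U).

Lemma isometric_comp A B C (V : hom B C) (U : hom A B) :
  isometric V -> isometric U -> isometric (hcomp V U).
Proof. by move=> iV iU x; have := iV (U x); rewrite /= => ->; exact: iU. Qed.

Lemma unitary_central A B (U : hom A B) : unitary_hom U -> central U.
Proof. by move=> [iU iU']; split=> // T x; rewrite !(iU' _ : U (adj U _) = _). Qed.

Lemma unitary_adj A B (U : hom A B) : unitary_hom U -> unitary_hom (adj U).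
Proof. by case. Qed.

Lemma unitary_comp A B C (V : hom B C) (U : hom A B) :
  unitary_hom V -> unitary_hom U -> unitary_hom (hcomp V U).
Proof.
by move=> [iV iV'] [iU iU']; split; [exact: isometric_comp|
  exact: (isometric_comp (V := adj U) (U := adj V))].
Qed.

Section CentralTheory.
Variables (A B : cdd_tuple R N) (V : hom A B).
Hypothesis cV : central V.

Lemma centralK x : adj V (V x) = x. Proof. exact: cV.1. Qed.

Lemma centralC (T : hom B B) x : V (adj V (T x)) = T (V (adj V x)).
Proof. exact: cV.2. Qed.

Lemma central_adj (T : hom B B) x : adj V (T (V (adj V x))) = adj V (T x).
Proof. by rewrite -centralC centralK. Qed.

Lemma central_ran (T : hom B B) x : V (adj V (T (V x))) = T (V x).
Proof. by rewrite centralC centralK. Qed.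
End CentralTheory.

(** For T on the largest space, (adj V) T V is a self-intertwiner of the middle
one, hence commutes with the range projection of U. *)
Lemma central_comp A B C (V : hom B C) (U : hom A B) :
  central V -> central U -> central (hcomp V U).
Proof.
move=> cV cU; split; first by apply: isometric_comp; [exact: cV.1|exact: cU.1].
move=> T x; rewrite !hcompE !adj_hcompE -central_adj//.
by rewrite (centralC cU (hcomp (adj V) (hcomp T V))) !hcompE central_ran.
Qed.

Lemma central_factor A B C (V : hom A C) (W : hom B C) : central V -> isometric W ->
  (forall x, W (adj W (V x)) = V x) -> central (hcomp (adj W) V).
Proof.
move=> cV iW VW; split=> [x|T x].
  by rewrite !hcompE adj_hcompE adjK VW centralK.
rewrite !hcompE !adj_hcompE !adjK.
have := centralC cV (hcomp W (hcomp T (adj W))) (W x).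
by rewrite !hcompE !iW => ->; rewrite iW.
Qed.

(** W T (adj V) is a self-intertwiner of C that maps the range of V into that of W,
but it has to preserve the central range of V, which is orthogonal to W. *)
Lemma central_hom0 A B C (V : hom A C) (W : hom B C) : central V -> isometric W ->
  (forall x, adj V (W x) = 0) -> forall (T : hom A B) x, T x = 0.
Proof.
move=> cV iW VW T x; rewrite -[LHS]iW.
have := central_ran cV (hcomp W (hcomp T (adj V))) x.
by rewrite !hcompE centralK// VW hom0 => <-; rewrite hom0.
Qed.

(** The intertwiner W T (adj V) maps the range of V isometrically into the
central range of W; as it commutes with the projection on the latter, it only
sees the component of V x in that range, which thus has full length. *)
Lemma isometric_sub_central A B C (V : hom A C) (W : hom B C) (T : hom A B) :
  isometric V -> central W -> isometric T -> forall x, W (adj W (V x)) = V x.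
Proof.
move=> iV cW iT x.
have : V x - W (adj W (V x)) = 0; last by move/eqP; rewrite subr_eq0 => /eqP.
have xx : adj V (W (adj W (V x))) = x.
  have := centralC cW (hcomp (hcomp W T) (adj V)) (V x).
  rewrite hcompE iV !hcompE (centralK cW) => /(congr1 (adj W)).
  by rewrite !(centralK cW) => /(congr1 (adj T)); rewrite !iT.
apply: inner_self_eq0; rewrite innerBr -adjE' -[inner _ (W _)]adjE'.
by rewrite !homB iV xx subrr (centralK cW) subrr !inner0l subrr.
Qed.

Lemma hom0_adj A B (T : hom A B) : (forall x, T x = 0) -> forall y, adj T y = 0.
Proof. by move=> T0 y; apply: inner_ext => x; rewrite adjE' T0 inner0l inner0r. Qed.

Lemma ueqP A B : ueq A B <-> exists U : hom A B, unitary_hom U.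
Proof.
split=> [[U [Ui Us] UG]|[U [iU iU']]].
  have /choice[V VK] := Us.
  have adjUV x y : inner (U x) y = inner x (V y) by rewrite -{1}[y]VK Ui.
  have VG j x y : graph (B j) (x, y) -> graph (A j) (V x, V y) by move=> xy; apply/UG; rewrite !VK.
  have UK x : V (U x) = x by apply: inner_ext => y; rewrite -[LHS]Ui VK Ui.
  by exists (Hom adjUV (fun j x y => (UG j x y).1) VG); split.
have Ulin : linear U by move=> a x y; exact: hom_lin.
pose L := GRing.isLinear.Build _ _ _ _ U Ulin.
pose U' : {linear space A -> space B} := HB.pack (fw U) L.
exists U'.
  by split=> [x y|z]; [rewrite adjE iU|exists (adj U z); exact: iU'].
move=> j x y; split; first exact: fw_graph.
by move=> xy; have := @fw_graph _ _ _ _ (adj U) j _ _ xy; rewrite !(iU _ : adj U (U' _) = _).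
Qed.

(** The range of V is the equalizer of V (adj V) and the identity. *)
Lemma isometric_range A B (V : hom A B) : isometric V ->
  exists2 E : csubspace (space B), forall y, proj E y = V (adj V y) & red E /\ ueq A (restr E).
Proof.
move=> iV; pose E := equalizer (fun _ : unit => hcomp V (adj V)) (fun _ => hid B).
have rE : red E by exact: equalizer_red.
have EP y : csub_set E y <-> V (adj V y) = y.
  by rewrite equalizerP; split=> [/(_ tt)|? []].
have pE y : proj E y = V (adj V y).
  apply: proj_eq; first by apply/EP; rewrite iV.
  by move=> z /EP Ez; rewrite innerBl adjE adjE' Ez subrr.
exists E => //; split=> //; apply/(ueqP A (sub_tuple rE)).
exists (hcomp (adj (incl rE)) V); split=> [x|x].
  by rewrite hcompE adj_hcompE adjK incl_adj pE !iV.
rewrite adj_hcompE adjK !hcompE !adjK -pE -incl_adj.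
by rewrite inclK inclK.
Qed.

Lemma ueq_restr A B (E : csubspace (space B)) : red E -> ueq A (restr E) ->
  exists2 V : hom A B, isometric V & forall y, V (adj V y) = proj E y.
Proof.
move=> rE /(ueqP A (sub_tuple rE))[U [iU iU']].
exists (hcomp (incl rE) U) => [x|y]; first by rewrite adj_hcompE hcompE inclK iU.
by rewrite adj_hcompE hcompE (iU' _ : U (adj U _) = _) incl_adj.
Qed.

(** Let P be the projection on E and T' = (1 - P) T P. The graph of T', seen as the
set of the vectors k with (1 - P) k = T' k, is an equalizer, hence reducing. It
contains P x + T' x; as its projection commutes with P, it also contains P x,
so T' x = 0. The same for the adjoint of T gives commutation. *)
Lemma credP A (E : csubspace (space A)) : cred E <->
  red E /\ forall (T : hom A A) x, proj E (T x) = T (proj E x).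
Proof.
split=> [[rE cE]|[rE cE]]; last first.
  by split=> // K rK x; have := cE (hcomp (incl rK) (adj (incl rK))) x.
split=> //.
pose P : hom A A := hcomp (incl rE) (adj (incl rE)).
pose Q := hlincomb (-1) P (hid A).
have PE x : P x = proj E x by [].
have QE x : Q x = x - proj E x.
  by rewrite [LHS]/= rmorphN rmorph1 scaleN1r addrC.
suff QTP (T : hom A A) x : Q (T (P x)) = 0.
  move=> T x.
  have e1 (S : hom A A) y : proj E (S (proj E y)) = S (proj E y).
    by apply/esym/eqP; rewrite -subr_eq0; apply/eqP; have := QTP S y; rewrite QE.
  apply: inner_ext => z.
  rewrite proj_adj adjE -(e1 (adj T)) -proj_adj -adjE -proj_adj.
  by rewrite e1.
pose T' := hcomp Q (hcomp T P).
have TE y : T' y = Q (T (proj E y)) by [].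
clearbody T'.
pose K := equalizer (fun _ : unit => Q) (fun _ => T').
have rK : red K by exact: equalizer_red.
have PP y : proj E (proj E y) = proj E y by rewrite proj_id//; exact: proj_in.
have QP y : Q (proj E y) = 0 by rewrite QE PP subrr.
have PQ y : proj E (Q y) = 0.
  by rewrite QE -PE homB !PE PP subrr.
have QQ y : Q (Q y) = Q y by rewrite {1}QE PQ subr0.
(* The graph of T' is {y + T' y : y in E}. *)
have Kv : csub_set K (proj E x + T' x).
  apply/equalizerP => _; change (Q (proj E x + T' x) = T' (proj E x + T' x)).
  by rewrite !homD QP add0r !TE QQ PP PQ !hom0 addr0.
have := cE K rK (proj E x + T' x); rewrite (proj_id Kv).
rewrite -PE homD !PE (TE x) PQ addr0 PP => PKx.
have : csub_set K (proj E x) by rewrite PKx; exact: proj_in.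
by move/equalizerP => /(_ tt); rewrite QP TE PP.
Qed.

Lemma central_range A B (V : hom A B) : central V ->
  exists2 E : csubspace (space B), forall y, proj E y = V (adj V y) & cred E /\ ueq A (restr E).
Proof.
move=> [iV cV]; have [E pE [rE eE]] := isometric_range iV.
by exists E => //; split=> //; apply/credP; split=> // T x; rewrite !pE.
Qed.

Lemma cred_restr A B (E : csubspace (space B)) : cred E -> ueq A (restr E) ->
  exists2 V : hom A B, central V & forall y, V (adj V y) = proj E y.
Proof.
move=> /credP[rE cE] /(ueq_restr rE)[V iV pV]; exists V => //.
by split=> // T x; rewrite !pV.
Qed.

Lemma unitary_id A : unitary_hom (hid A). Proof. by []. Qed.
End Central.

Section Classes.
Context {R : realType} {N : nat}.
Implicit Types A B C : cdd_tuple R N.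
Implicit Types X Y Z : ucdd R N.

Lemma membersE X A : members X A <-> exists U : hom (urepr X) A, unitary_hom U.
Proof. by rewrite -ueqP /urepr; case: cid => B /= ->. Qed.

Lemma members_urepr X : members X (urepr X).
Proof. by apply/membersE; exists (hid _); exact: unitary_id. Qed.

(** Classes with the same members are equal by extensionality. *)
Lemma ucdd_eqP X Y : X = Y <-> exists U : hom (urepr X) (urepr Y), unitary_hom U.
Proof.
split=> [->|[U uU]]; first by exists (hid _); exact: unitary_id.
have m : members X = members Y.
  apply/predeqP => A; rewrite !membersE; split=> -[V uV].
    by exists (hcomp V (adj U)); apply: unitary_comp => //; exact: unitary_adj.
  by exists (hcomp V U); apply: unitary_comp.
case: X Y m {U uU} => [m mP] [m' mP'] /= mm'; rewrite mm' in mP *.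
by congr UCDD; exact: Prop_irrelevance.
Qed.

Lemma uclass_repr A : exists U : hom (urepr (uclass A)) A, unitary_hom U.
Proof. by apply/membersE => /=; apply/ueqP; exists (hid _); exact: unitary_id. Qed.

Lemma uleP X Y : ule X Y <-> exists V : hom (urepr X) (urepr Y), isometric V.
Proof.
split=> [[A [B [/membersE[U uU] /membersE[W uW] [E rE /(ueq_restr rE)[V iV _]]]]]|[V iV]].
  exists (hcomp (adj W) (hcomp V U)); apply: isometric_comp; first exact: uW.2.
  exact: isometric_comp uU.1.
exists (urepr X), (urepr Y); split; try exact: members_urepr.
by have [E _ [rE eE]] := isometric_range iV; exists E.
Qed.

Lemma sleP X Y : sle X Y <-> exists V : hom (urepr X) (urepr Y), central V.
Proof.
split=> [[A [B [/membersE[U uU] /membersE[W uW] [E cE /(cred_restr cE)[V cV _]]]]]|[V cV]].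
  exists (hcomp (adj W) (hcomp V U)); apply: central_comp.
    exact/unitary_central/unitary_adj.
  by apply: central_comp => //; exact: unitary_central.
exists (urepr X), (urepr Y); split; try exact: members_urepr.
by have [E _ [rE eE]] := central_range cV; exists E.
Qed.

Lemma sle_ule X Y : sle X Y -> ule X Y.
Proof. by move=> /sleP[V [iV _]]; apply/uleP; exists V. Qed.

(** Inside the common bound, [isometric_sub_central] puts the copy of X into that of
Y. *)
Lemma sle_of_ule X Y Z : sle X Z -> sle Y Z -> ule X Y -> sle X Y.
Proof.
move=> /sleP[V cV] /sleP[W cW] /uleP[T iT]; apply/sleP.
exists (hcomp (adj W) V); apply: central_factor => //; first exact: cW.1.
exact: isometric_sub_central cV.1 cW iT.
Qed.
End Classes.

(** * Gluing by projections, and the Cantor-Bernstein theorem *)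

Section BinarySum.
Context {R : realType} {N : nat}.
Implicit Types A B C : cdd_tuple R N.

Program Definition hinl A B : hom A (cdd_sum A B) :=
  @Hom R N A (cdd_sum A B) (fun x => (x, 0) : hsum _ _) fst _ _ _.
Next Obligation. by move=> A B x y; rewrite inner_hsum /= inner0l addr0. Qed.
Next Obligation. by move=> A B j x y xy; split=> //=; exact: graph0. Qed.
Next Obligation. by move=> A B j x y []. Qed.

Program Definition hinr A B : hom B (cdd_sum A B) :=
  @Hom R N B (cdd_sum A B) (fun x => (0, x) : hsum _ _) snd _ _ _.
Next Obligation. by move=> A B x y; rewrite inner_hsum /= inner0l add0r. Qed.
Next Obligation. by move=> A B j x y xy; split=> //=; exact: graph0. Qed.
Next Obligation. by move=> A B j x y []. Qed.

Lemma hinlE A B (x : space A) : hinl A B x = (x, 0). Proof. by []. Qed.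
Lemma hinrE A B (x : space B) : hinr A B x = (0, x). Proof. by []. Qed.

Lemma hlincombE A B (a : R) (T S : hom A B) x : hlincomb a T S x = a%:C *: T x + S x.
Proof. by []. Qed.

Lemma adj_hlincombE A B (a : R) (T S : hom A B) x :
  adj (hlincomb a T S) x = a%:C *: adj T x + adj S x.
Proof. by []. Qed.

(** The pairs (S i x, T i x) span a subspace G of A + B on which both coordinates
have the same length, and (a, b) is orthogonal to G iff it lies in the
equalizer E below. With Q = 1 - P_E, the map W a = 2 (Q (a, 0)).2 is the partial
isometry from the closed span of the S i to that of the T i: if (u, W u) runs
through the closure of G, then (u, 0) = (u, W u) / 2 + (u, - W u) / 2 is its
decomposition along G and E. *)
Lemma pairing A B (I : Type) (X : I -> cdd_tuple R N)
    (S : forall i, hom (X i) A) (T : forall i, hom (X i) B) :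
  (forall i k x, adj (S i) (S k x) = adj (T i) (T k x)) ->
  exists W : hom A B, [/\ forall i x, W (S i x) = T i x,
    forall i x, adj W (T i x) = S i x,
    forall a, (forall i, adj (S i) a = 0) -> W a = 0 &
    forall b, (forall i, adj (T i) b = 0) -> adj W b = 0].
Proof.
move=> ST; pose C := cdd_sum A B.
pose N1 i := hcomp (adj (S i)) (adj (hinl A B)).
pose N2 i := hlincomb (-1) (hcomp (adj (T i)) (adj (hinr A B))) (hzero C (X i)).
pose E := equalizer N1 N2; have rE : red E by exact: equalizer_red.
have EP (u : space C) : csub_set E u <-> forall i, adj (S i) u.1 = - adj (T i) u.2.
  rewrite equalizerP; split=> h i; have := h i.
    by rewrite hlincombE rmorphN rmorph1 scaleN1r addr0.
  by rewrite hlincombE rmorphN rmorph1 scaleN1r addr0.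
pose P := hcomp (incl rE) (adj (incl rE)).
pose Q := hlincomb (-1) P (hid C).
have QE x : Q x = x - proj E x.
  by rewrite hlincombE rmorphN rmorph1 scaleN1r addrC.
have QE' x : adj Q x = x - proj E x.
  by rewrite adj_hlincombE rmorphN rmorph1 scaleN1r addrC.
pose W1 := hcomp (adj (hinr A B)) (hcomp Q (hinl A B)).
have W1E a : W1 a = (Q ((a, 0) : space C)).2 by [].
have W1E' b : adj W1 b = (adj Q ((0, b) : space C)).1 by [].
(* W1 is half of the partial isometry; the sum W1 + W1 doubles it. *)
exists (hlincomb 1 W1 W1); clearbody P Q W1.
have WE x : hlincomb 1 W1 W1 x = W1 (x + x) by rewrite hlincombE scale1r -homD.
have WE' x : adj (hlincomb 1 W1 W1) x = adj W1 (x + x) by rewrite adj_hlincombE scale1r -homD.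
have orth i x z : csub_set E z -> inner (S i x) z.1 + inner (T i x) z.2 = 0.
  by move=> /EP/(_ i) Sz; rewrite !adjE Sz -innerDr addNr inner0r.
split=> [i x|i x|a Sa|b Tb].
- rewrite WE W1E QE.
  have -> : proj E ((S i x + S i x, 0) : space C) = (S i x, - T i x).
    apply: proj_eq => [|z Ez]; last first.
      by rewrite inner_hsum /= addrK sub0r opprK; exact: orth.
    apply/EP => k; change (adj (S k) (S i x) = - adj (T k) (- T i x)).
    by rewrite ST -[- T i x]sub0r homB hom0 sub0r opprK.
  by rewrite /= sub0r opprK.
- rewrite WE' W1E' QE'.
  have -> : proj E ((0, T i x + T i x) : space C) = (- S i x, T i x).
    apply: proj_eq => [|z Ez]; last first.
      by rewrite inner_hsum /= addrK sub0r opprK; exact: orth.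
    apply/EP => k; change (adj (S k) (- S i x) = - adj (T k) (T i x)).
    by rewrite -ST -[- S i x]sub0r homB hom0 sub0r.
  by rewrite /= sub0r opprK.
- rewrite WE W1E QE proj_id ?subrr//; apply/EP => i.
  change (adj (S i) (a + a) = - adj (T i) 0).
  by rewrite homD Sa hom0 addr0 oppr0.
- rewrite WE' W1E' QE' proj_id ?subrr//; apply/EP => i.
  change (adj (S i) 0 = - adj (T i) (b + b)).
  by rewrite homD Tb hom0 addr0 oppr0.
Qed.

(** When the S i are jointly dense, W is isometric because [adj W W x - x] is
orthogonal to the range of every S i. *)
Lemma pairing_isometric A B (I : Type) (X : I -> cdd_tuple R N)
    (S : forall i, hom (X i) A) (T : forall i, hom (X i) B) :
  (forall i k x, adj (S i) (S k x) = adj (T i) (T k x)) ->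
  (forall a, (forall i, adj (S i) a = 0) -> a = 0) ->
  exists W : hom A B, [/\ isometric W, forall i x, W (S i x) = T i x &
     forall i x, adj W (T i x) = S i x].
Proof.
move=> ST S0; have [W [WS WT _ _]] := pairing ST.
exists W; split=> // x; apply/eqP; rewrite -subr_eq0; apply/eqP/S0 => i.
apply: inner_ext => z; rewrite inner0l adjE' innerBl adjE' WS adjE.
by rewrite WT subrr.
Qed.

(** With t = W V, the vectors whose backward orbit under adj t stays in the range
of W form an equalizer; let p be the projection on it and q = 1 - p, the
projection on the closed span of the ranges of t^n (1 - W (adj W)). Then V on q and adj W
on p together are unitary, because p = W (adj W) - t q (adj t). *)
Lemma cantor_bernstein A B (V : hom A B) (W : hom B A) :
  isometric V -> isometric W -> exists U : hom A B, unitary_hom U.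
Proof.
move=> iV iW; pose t := hcomp W V.
have it : isometric t by exact: isometric_comp.
pose tn n := iter n (hcomp (adj t)) (hid A).
have tnS n x : tn n.+1 x = tn n (adj t x).
  elim: n x => // n IH x; change (adj t (tn n.+1 x) = adj t (tn n (adj t x))).
  by rewrite IH.
pose E := equalizer (fun n => hcomp (hcomp W (adj W)) (tn n)) tn.
have rE : red E by exact: equalizer_red.
have EP x : csub_set E x <-> forall n, W (adj W (tn n x)) = tn n x by exact: equalizerP.
pose p := hcomp (incl rE) (adj (incl rE)).
have pE x : p x = proj E x by [].
have pE' x : adj p x = p x by [].
have Ep x : csub_set E (p x) by exact: proj_in.
have p_id x : csub_set E x -> p x = x by rewrite pE; exact: proj_id.
pose q := hlincomb (-1) p (hid A).
have qE x : q x = x - p x by rewrite hlincombE rmorphN rmorph1 scaleN1r addrC.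
have qE' x : adj q x = q x.
  by rewrite qE adj_hlincombE pE' rmorphN rmorph1 scaleN1r addrC.
have tn0 x : tn 0%N x = x by [].
clearbody p q tn.
have Wp x : W (adj W (p x)) = p x.
  by have /EP/(_ 0%N) := Ep x; rewrite tn0.
have pt x : p (adj t (p x)) = adj t (p x).
  by apply: p_id; apply/EP => n; rewrite -tnS; move: n.+1; apply/EP.
have tE x : t x = W (V x) by [].
have tE' x : adj t x = adj V (adj W x) by [].
have pp x : p (p x) = p x by exact: p_id.
have qp x : q (p x) = 0 by rewrite qE pp subrr.
have pq x : p (q x) = 0 by rewrite qE homB pp subrr.
have qq x : q (q x) = q x by rewrite {1}qE pq subr0.
have qtp x : q (adj t (p x)) = 0 by rewrite qE pt subrr.
have p'E x : p x = W (adj W x) - t (q (adj t x)).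
  pose p' x := W (adj W x) - t (q (adj t x)).
  (* p' y satisfies the conditions that define the range of p: it lies in the range
     of W, and adj t maps it to p (adj t y). *)
  have Ep' y : p (p' y) = p' y.
    apply: p_id; apply/EP => -[|n].
      by rewrite tn0 /p' !homB iW !tE iW.
    suff -> : tn n.+1 (p' y) = tn n (p (adj t y)) by move: n; apply/EP.
    rewrite tnS; congr (tn _ _).
    by rewrite /p' homB it !tE' iW qE opprB addrC subrK.
  apply: inner_ext => z; rewrite -/(p' x) -Ep'.
  rewrite (adjE p) [RHS](adjE p) pE' /p' innerBl.
  rewrite (adjE t) (adjE q) qE' qtp inner0r subr0.
  by rewrite (adjE W) adjE' Wp.
have ptq x : p (t (q x)) = 0.
  by apply: inner_ext => z; rewrite (adjE p) pE' (adjE t) (adjE q) qE' qtp inner0r inner0l.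
exists (hlincomb 1 (hcomp V q) (hcomp (adj W) p)); split=> [x|y].
  rewrite adj_hlincombE hlincombE !scale1r !adj_hcompE !hcompE adjK !homD iV !qE' !pE' !qq.
  by rewrite -tE' -tE qtp Wp ptq pp addr0 add0r qE subrK.
rewrite adjK adj_hlincombE hlincombE !scale1r !adj_hcompE !hcompE adjK !homD.
rewrite !qE' !pE' qq pq qp pp.
rewrite !hom0 addr0 add0r.
by rewrite p'E iW homB iW tE' iW tE iW addrC subrK.
Qed.
End BinarySum.

(** * Square roots and unitary disjointness *)

Section SquareRoot.
Context {R : realType} {N : nat}.
Implicit Types A B : cdd_tuple R N.

Definition contractive A B (T : hom A B) := forall x, nrm (T x) <= nrm x.

Lemma norm_le_eps_eq0 (d : R[i]) : (forall e : R, 0 < e -> `|d| <= e%:C) -> d = 0.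
Proof.
have /complex_realP[r dr] : `|d| \is Num.real by rewrite ger0_real.
move=> de; apply/eqP; rewrite -normr_eq0 dr; have r0 : 0 <= r by rewrite -ler0c -dr.
suff -> : r = 0 by [].
apply/le_anti; rewrite r0 andbT; apply/ler_addgt0Pr => e e0.
by rewrite add0r -lecR -dr; exact: de.
Qed.

Lemma re_inner_le (H : hilbertType R) (x y : H) : complex.Re (inner x y) <= nrm x * nrm y.
Proof.
rewrite -lecR; apply: le_trans (inner_bound x y).
apply: le_trans (normc_ge_Re _); rewrite lecR; exact: ler_norm.
Qed.

Lemma contractive_adj A B (T : hom A B) : contractive T -> contractive (adj T).
Proof.
move=> cT y; have [->|y0] := eqVneq (nrm (adj T y)) 0; first exact: nrm_ge0.
have n0 : 0 < nrm (adj T y) by rewrite lt_def y0 nrm_ge0.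
rewrite -(ler_pM2l n0) -expr2.
have -> : nrm (adj T y) ^+ 2 = complex.Re (inner (T (adj T y)) y).
  by rewrite adjE inner_nrm.
by apply: (le_trans (re_inner_le _ _)); rewrite ler_wpM2r ?nrm_ge0.
Qed.

(** The iterates of t |-> (1 + t^2) / 2 from 0; they increase to a limit at most 1
and control the operator iteration [approx], which is the same recursion with
the contraction X in place of 1. *)
Fixpoint half_iter (n : nat) : R :=
  if n is n'.+1 then (1 + half_iter n' ^+ 2) / 2 else 0.

Lemma half_iter_bound n : 0 <= half_iter n <= 1.
Proof.
elim: n => [|n /andP[t0 t1]] /=; first by rewrite lexx ler01.
have : half_iter n ^+ 2 <= 1 by rewrite expr_le1.
have := sqr_ge0 (half_iter n); move: (_ ^+ 2) => s s0 s1.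
by apply/andP; split; lra.
Qed.

Lemma half_iter_le n m : (n <= m)%N -> half_iter n <= half_iter m.
Proof.
elim: m => [|m IH]; first by rewrite leqn0 => /eqP ->.
rewrite leq_eqVlt => /orP[/eqP -> //|/IH nm]; apply: (le_trans nm) => /=.
have := sqr_ge0 (half_iter m - 1); rewrite sqrrB expr1n mulr1; move: (_ ^+ 2) => s; lra.
Qed.

Lemma half_iter_cauchy (e : R) : 0 < e ->
  exists n, forall m, (n <= m)%N -> half_iter m - half_iter n < e.
Proof.
pose S := [set half_iter n | n in [set: nat]].
have hS : has_sup S.
  split; first by exists (half_iter 0), 0%N.
  by exists 1 => _ [n _ <-]; have /andP[] := half_iter_bound n.
move=> e0; have [_ [n _ <-] ne] := sup_adherent e0 hS.
exists n => m nm; have : half_iter m <= sup S by apply: sup_ubound; [exact: hS.2|exists m].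
lra.
Qed.

Section Root.
Variables (A : cdd_tuple R N) (X : hom A A).
Hypothesis cX : contractive X.
Hypothesis sX : forall x, adj X x = X x.

(** Each iterate is a self-adjoint intertwiner, being a polynomial in X. *)
Fixpoint approx n : hom A A :=
  if n is n'.+1 then hlincomb 2^-1 (hlincomb 1 X (hcomp (approx n') (approx n'))) (hzero A A)
  else hzero A A.

Lemma approxS n x : approx n.+1 x = 2^-1%:C *: (X x + approx n (approx n x)).
Proof. by rewrite [LHS]hlincombE hlincombE scale1r addr0. Qed.

Lemma approx_adj n x : adj (approx n) x = approx n x.
Proof.
elim: n x => // n IH x; rewrite approxS [LHS]adj_hlincombE adj_hlincombE scale1r addr0 sX.
by rewrite adj_hcompE !IH.
Qed.

Lemma half_norm (H : hilbertType R) (x : H) : nrm (2^-1%:C *: x) = 2^-1 * nrm x.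
Proof. by rewrite nrmZ ger0_norm// invr_ge0. Qed.

Lemma approx_le n x : nrm (approx n x) <= half_iter n * nrm x.
Proof.
elim: n x => [|n IH] x; first by rewrite mul0r [approx 0 x]/(0 : space A) nrm0.
rewrite approxS half_norm [half_iter n.+1]/= mulrAC [X in _ <= X]mulrC.
rewrite ler_pM2l ?invr_gt0// (le_trans (nrmD _ _))// mulrDl mul1r lerD//.
apply: (le_trans (IH _)); rewrite expr2 -mulrA ler_wpM2l//.
by have /andP[] := half_iter_bound n.
Qed.

(** The difference of two consecutive steps is
(Y' (Y' - Y) + (Y' - Y) Y) / 2, which mirrors the factorization of the
difference of squares in the scalar recursion. *)
Lemma approx_diff n x :
  nrm (approx n.+1 x - approx n x) <= (half_iter n.+1 - half_iter n) * nrm x.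
Proof.
elim: n x => [|n IH] x.
  rewrite approxS [approx 0 _]/(0 : space A) addr0 subr0 half_norm /=.
  by rewrite expr0n /= addr0 subr0 mul1r ler_pM2l ?invr_gt0.
rewrite (approxS n.+1) [X in nrm (_ - X)]approxS -scalerBr half_norm.
rewrite opprD addrACA subrr add0r.
set D := fun x => approx n.+1 x - approx n x.
have -> : approx n.+1 (approx n.+1 x) - approx n (approx n x) =
    approx n.+1 (D x) + D (approx n x).
  by rewrite /D homB addrA subrK.
set p := half_iter n.+1; set q := half_iter n.
have -> : half_iter n.+2 - p = 2^-1 * (p * (p - q) + (p - q) * q).
  have e2 : half_iter n.+2 = (1 + p ^+ 2) / 2 by [].
  have e1 : p = (1 + q ^+ 2) / 2 by [].
  by rewrite e2 [X in _ - X = _]e1; field.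
have p0 : 0 <= p by have /andP[] := half_iter_bound n.+1.
have pq : 0 <= p - q by rewrite subr_ge0 half_iter_le.
rewrite -mulrA ler_pM2l ?invr_gt0//; apply: (le_trans (nrmD _ _)).
rewrite mulrDl; apply: lerD.
  by apply: (le_trans (approx_le _ _)); rewrite -/p -mulrA ler_wpM2l//; exact: IH.
by apply: (le_trans (IH _)); rewrite -mulrA ler_wpM2l//; exact: approx_le.
Qed.

Lemma approx_cauchy n m x : (n <= m)%N ->
  nrm (approx m x - approx n x) <= (half_iter m - half_iter n) * nrm x.
Proof.
elim: m => [|m IH]; first by rewrite leqn0 => /eqP ->; rewrite !subrr nrm0 mul0r.
rewrite leq_eqVlt => /orP[/eqP ->|/IH nm]; first by rewrite !subrr nrm0 mul0r.
have -> : approx m.+1 x - approx n x =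
  (approx m.+1 x - approx m x) + (approx m x - approx n x) by rewrite addrA subrK.
have -> : half_iter m.+1 - half_iter n =
  (half_iter m.+1 - half_iter m) + (half_iter m - half_iter n) by rewrite addrA subrK.
by rewrite mulrDl; apply: (le_trans (nrmD _ _)); rewrite lerD// approx_diff.
Qed.

Lemma approx_limit : exists L : space A -> space A, forall x (e : R), 0 < e ->
  exists n, forall m, (n <= m)%N -> nrm (L x - approx m x) < e.
Proof.
suff /choice[L LP] : forall x, exists l, forall e : R, 0 < e ->
    exists n, forall m, (n <= m)%N -> nrm (l - approx m x) < e by exists L.
move=> x; apply: complete_seq => e e0.
have x1 : 0 < nrm x + 1 by rewrite ltr_wpDl// nrm_ge0.
have [n ne] := half_iter_cauchy (divr_gt0 e0 x1); exists n => m nm.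
rewrite nrmB; apply: (le_lt_trans (approx_cauchy _ nm)).
apply: (@le_lt_trans _ _ ((half_iter m - half_iter n) * (nrm x + 1))).
  by rewrite ler_wpM2l ?subr_ge0 ?half_iter_le// lerDl.
by rewrite -ltr_pdivlMr// ne.
Qed.

(** The limit L of the iteration satisfies L = (X + L^2) / 2, that is
(1 - L)^2 = 1 - X. *)
Lemma square_root : exists S : hom A A,
  (forall x, adj S x = S x) /\ forall x, S (S x) = x - X x.
Proof.
have [L Llim] := approx_limit.
have Ladj x y : inner (L x) y = inner x (L y).
  apply/eqP; rewrite -subr_eq0; apply/eqP/norm_le_eps_eq0 => e e0.
  set k := nrm x + nrm y + 1.
  have k0 : 0 < k by rewrite ltr_wpDl// addr_ge0 ?nrm_ge0.
  have [n1 nx] := Llim x _ (divr_gt0 e0 k0); have [n2 ny] := Llim y _ (divr_gt0 e0 k0).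
  pose n := maxn n1 n2.
  have {nx} := nx n (leq_maxl _ _); have {ny} := ny n (leq_maxr _ _).
  move=> ny nx.
  have -> : inner (L x) y - inner x (L y) =
     inner (L x - approx n x) y - inner x (L y - approx n y).
    by rewrite innerBl innerBr -adjE' approx_adj opprB addrA subrK.
  apply: (le_trans (ler_normB _ _)).
  apply: (le_trans (lerD (inner_bound _ _) (inner_bound _ _))).
  rewrite -rmorphD lecR /=.
  have := ler_wpM2r (nrm_ge0 y) (ltW nx); have := ler_wpM2l (nrm_ge0 x) (ltW ny).
  have : e / k * nrm y + nrm x * (e / k) <= e.
    have -> : e / k * nrm y + nrm x * (e / k) = (nrm x + nrm y) * e / k by ring.
    by rewrite ler_pdivrMr// mulrC ler_pM2l// lerDl.
  lra.
have Lgraph j x y : graph (A j) (x, y) -> graph (A j) (L x, L y).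
  move=> xy; have [/closed_prod_nrm cA _] := cdd_opP A j; apply: cA => e e0.
  have [n1 nx] := Llim x _ e0; have [n2 ny] := Llim y _ e0.
  exists (approx (maxn n1 n2) x), (approx (maxn n1 n2) y); split.
  - exact: fw_graph.
  - exact: nx (leq_maxl _ _).
  - exact: ny (leq_maxr _ _).
pose Lh : hom A A := Hom Ladj Lgraph Lgraph.
have Leq x : L x = 2^-1%:C *: (X x + L (L x)).
  apply/eqP; rewrite -subr_eq0; apply/eqP/nrm_le0 => e e0.
  have e4 : 0 < e / 4 by rewrite divr_gt0.
  have [n1 h1] := Llim x _ e4; have [n2 h2] := Llim (L x) _ e4.
  pose n := maxn n1 n2.
  have := h1 n.+1 (leqW (leq_maxl _ _)); have := h1 n (leq_maxl _ _).
  have := h2 n (leq_maxr _ _) => {h1 h2} h2 h1 h1'.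
  have -> : L x - 2^-1%:C *: (X x + L (L x)) = (L x - approx n.+1 x) +
      2^-1%:C *: ((approx n (approx n x - L x)) + (approx n (L x) - L (L x))).
    rewrite homB addrA subrK approxS scalerBr scalerDr [in RHS]scalerDr.
    by rewrite !opprD !addrA subrK.
  apply: (le_trans (nrmD _ _)); rewrite half_norm.
  have := nrmD (approx n (approx n x - L x)) (approx n (L x) - L (L x)).
  have : nrm (approx n (approx n x - L x)) <= nrm (approx n x - L x).
    apply: (le_trans (approx_le _ _)); rewrite ler_piMl ?nrm_ge0//.
    by have /andP[] := half_iter_bound n.
  rewrite (nrmB (approx n x)) (nrmB (approx n (L x))).
  lra.
pose S := hlincomb (-1) Lh (hid A); exists S.
have SE x : S x = x - L x by rewrite [LHS]hlincombE rmorphN rmorph1 scaleN1r addrC.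
split=> [x|x].
  by rewrite SE [LHS]adj_hlincombE rmorphN rmorph1 scaleN1r addrC.
rewrite SE -[L (S x)]/(Lh (S x)) SE homB -![Lh _]/(L _) opprB addrA.
have two : L x + L x = X x + L (L x).
  rewrite {1 2}Leq -scalerDl -rmorphD (_ : 2^-1 + 2^-1 = 1) ?scale1r//=.
  lra.
have -> : x - L x + L (L x) - L x = x - (L x + L x) + L (L x).
  by rewrite opprD addrA addrAC.
by rewrite two opprD addrA subrK.
Qed.
End Root.

(** |x - adj T T x|^2 = |x|^2 - 2 |T x|^2 + |adj T T x|^2, and the last term is at
most |T x|^2. *)
Lemma contractive_defect A B (T : hom A B) : contractive T ->
  contractive (hlincomb (-1) (hcomp (adj T) T) (hid A)).
Proof.
move=> cT x; rewrite hlincombE rmorphN rmorph1 scaleN1r addrC hcompE.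
rewrite -ler_sqr ?nnegrE ?nrm_ge0// sqr_nrmB -adjE inner_nrm /=.
have : nrm (adj T (T x)) ^+ 2 <= nrm (T x) ^+ 2.
  by rewrite ler_sqr ?nnegrE ?nrm_ge0//; exact: contractive_adj.
have := sqr_ge0 (nrm (T x)); move: (_ ^+ 2) (_ ^+ 2) (_ ^+ 2) => a b c.
lra.
Qed.

(** Polar decomposition: with S the square root of adj T T, [pairing] sends S x to
T x by a partial isometry W. Its initial space embeds in A and in B, hence is
trivial, so W = 0 and T = W S = 0. *)
Lemma schur A B (T : hom A B) : contractive T ->
  (forall (C : cdd_tuple R N) (V : hom C A) (W : hom C B), isometric V -> isometric W ->
    forall x : space C, x = 0) -> forall x, T x = 0.
Proof.
move=> cT AB.
have [|S [sS SS]] := square_root (contractive_defect cT).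
  by move=> x; rewrite adj_hlincombE hlincombE adj_hcompE hcompE.
have ST x : S (S x) = adj T (T x).
  by rewrite SS hlincombE rmorphN rmorph1 scaleN1r opprD opprK addrC addrNK.
have [|W [WS WT _ WT0]] := @pairing _ _ A B unit (fun=> A) (fun=> S) (fun=> T).
  by move=> _ _ x; rewrite sS ST.
have {}WS := WS tt; have {}WT := WT tt.
have TW u : adj T (W u) = S u.
  by apply: inner_ext => v; rewrite adjE' adjE WT [RHS]adjE sS.
have SW u : S (adj W u) = adj T u.
  by apply: inner_ext => v; rewrite -sS !adjE' WS.
have WW x : adj W (W (adj W (W x))) = adj W (W x).
  apply/eqP; rewrite -subr_eq0; apply/eqP.
  have h : adj W (W (adj W (W x) - x)) = 0.
    by apply: WT0 => _; rewrite TW homB SW TW subrr.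
  by rewrite -homB -homB h.
pose E := equalizer (fun _ : unit => hcomp (adj W) W) (fun _ => hid A).
have rE : red E by exact: equalizer_red.
have EP x : csub_set E x <-> adj W (W x) = x.
  by rewrite equalizerP; split=> [/(_ tt)|? []].
have iW : isometric (hcomp W (incl rE)).
  move=> x; rewrite adj_hcompE hcompE (EP _).1 ?inclK//; exact: csub_valK.
have W0 x : W x = 0.
  have Ex : csub_set E (adj W (W x)) by apply/EP; exact: WW.
  have WWx : adj W (W x) = 0.
    rewrite -(proj_id Ex).
    rewrite -(@incl_adj _ _ _ _ rE).
    by rewrite (AB _ _ _ (@inclK _ _ _ _ rE) iW (adj (incl rE) _)) hom0.
  by apply: inner_self_eq0; rewrite adjE WWx inner0r.
by move=> x; rewrite -WS W0.
Qed.
End SquareRoot.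

(** * Square-summable families *)

Section RealSums.
Context {R : realType} {I : choiceType}.
Implicit Types (a b : I -> R) (A B : {fset I}).

(** Unconditional convergence, along the net of finite subsets of I. *)
Definition rsums a (c : R) := forall e : R, 0 < e ->
  exists A, forall B, (A `<=` B)%fset -> `|c - \sum_(i <- B) a i| <= e.

Lemma rsums_unique a c d : rsums a c -> rsums a d -> c = d.
Proof.
move=> ac ad; apply/eqP; rewrite -subr_eq0 -normr_eq0 eq_le normr_ge0 andbT.
apply/ler_addgt0Pr => e e0; rewrite add0r.
have e20 : 0 < e / 2 by rewrite divr_gt0.
have [A cA] := ac _ e20; have [B dB] := ad _ e20.
have := cA (A `|` B)%fset (fsubsetUl _ _).
have := dB (A `|` B)%fset (fsubsetUr _ _).
rewrite !ler_norml; lra.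
Qed.

Lemma rsums_lin k a b c d : rsums a c -> rsums b d ->
  rsums (fun i => k * a i + b i) (k * c + d).
Proof.
move=> ac bd e e0.
have k1 : 0 < 2 * (`|k| + 1) by rewrite mulr_gt0// ltr_wpDl.
have [A cA] := ac _ (divr_gt0 e0 k1); have [B dB] := bd _ (divr_gt0 e0 (ltr0n R 2)).
exists (A `|` B)%fset => D ABD; rewrite big_split /= -mulr_sumr.
have := cA D (fsubset_trans (fsubsetUl _ _) ABD).
have := dB D (fsubset_trans (fsubsetUr _ _) ABD).
move: (\sum_(i <- D) a i) (\sum_(i <- D) b i) => p q h1 h2.
have -> : k * c + d - (k * p + q) = k * (c - p) + (d - q) by ring.
apply: (le_trans (ler_normD _ _)); rewrite normrM.
have : `|k| * `|c - p| <= `|k| * (e / (2 * (`|k| + 1))) by rewrite ler_wpM2l.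
have : `|k| * (e / (2 * (`|k| + 1))) <= e / 2.
  rewrite mulrA ler_pdivrMr// mulrA divfK ?pnatr_eq0// mulrC ler_wpM2l ?ltW//.
  by rewrite ltrDl.
lra.
Qed.

Lemma rsums_one a i : (forall k, k != i -> a k = 0) -> rsums a (a i).
Proof.
move=> a0 e e0; exists [fset i]%fset => B /fsubsetP iB.
rewrite (big_fsetD1 i) ?iB ?inE//= big1_seq ?addr0 ?subrr ?normr0 ?ltW//.
by move=> k /andP[_]; rewrite !inE => /andP[/a0].
Qed.

Lemma sum_fset_le a A B : (forall i, 0 <= a i) -> (A `<=` B)%fset ->
  \sum_(i <- A) a i <= \sum_(i <- B) a i.
Proof.
move=> a0 /fsubsetP AB; rewrite (big_fsetID _ (mem A) B) /=.
have -> : [fset x | x in B & x \in A]%fset = A.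
  by apply/fsetP => x; rewrite !inE /=; apply/andP/idP => [[]//|xA]; split=> //; exact: AB.
by rewrite lerDl sumr_ge0.
Qed.

(** The sum is the supremum of the finite sums. *)
Lemma rsums_ge0 a M : (forall i, 0 <= a i) -> (forall A, \sum_(i <- A) a i <= M) ->
  exists c, [/\ rsums a c, c <= M & forall A, \sum_(i <- A) a i <= c].
Proof.
move=> a0 aM; pose S := [set \sum_(i <- A) a i | A in [set: {fset I}]].
have hS : has_sup S.
  by split; [exists (\sum_(i <- fset0) a i); exists fset0|exists M => _ [A _ <-]].
have Sub A : \sum_(i <- A) a i <= sup S by apply: sup_ubound; [exact: hS.2|exists A].
exists (sup S); split=> //; last first.
  by apply: sup_le_ub => [|_ [A _ <-]//]; exact: hS.1.
move=> e e0; have [_ [A _ <-] eA] := sup_adherent e0 hS.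
exists A => B AB; have := sum_fset_le a0 AB; have := Sub B.
rewrite ler_norml; lra.
Qed.

Definition rsum a := xget 0 [set c | rsums a c].

Lemma rsumE a c : rsums a c -> rsum a = c.
Proof. by move=> ac; apply: (rsums_unique _ ac); exact: (xgetI _ ac). Qed.
End RealSums.

Section L2.
Context {R : realType} {I : choiceType} (H : I -> hilbertType R).

Definition l2_bound (f : forall i, H i) (M : R) :=
  forall A : {fset I}, \sum_(i <- A) nrm (f i) ^+ 2 <= M.

Record l2 := L2 { l2_fun :> forall i, H i ; l2P : exists M, l2_bound l2_fun M }.

Lemma l2_ext (f g : l2) : (forall i, f i = g i) -> f = g.
Proof.
case: f g => [f fP] [g gP] /= /(@functional_extensionality_dep _ _ f g) fg.
by rewrite fg in fP *; congr L2; exact: Prop_irrelevance.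
Qed.

HB.instance Definition _ := gen_eqMixin l2.
HB.instance Definition _ := gen_choiceMixin l2.

Lemma sqr_nrmD_le (K : hilbertType R) (x y : K) :
  nrm (x + y) ^+ 2 <= 2 * nrm x ^+ 2 + 2 * nrm y ^+ 2.
Proof.
have := nrmD x y; move: (nrm_ge0 x) (nrm_ge0 y) (nrm_ge0 (x + y)).
move: (nrm x) (nrm y) (nrm (x + y)) => p q r p0 q0 r0 rpq.
have : r ^+ 2 <= (p + q) ^+ 2 by rewrite ler_sqr// nnegrE addr_ge0.
have := sqr_ge0 (p - q); rewrite sqrrB sqrrD; lra.
Qed.

Lemma nrm_scale (K : hilbertType R) (a : R[i]) (x : K) :
  nrm (a *: x) = complex.Re `|a| * nrm x.
Proof.
apply: complexI; rewrite -nrmE normrZ nrmE rmorphM; congr (_ * _).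
Qed.

Lemma l2_lin (a : R[i]) (f g : l2) : exists M, l2_bound (fun i => a *: f i + g i) M.
Proof.
have [M fM] := l2P f; have [M' gM'] := l2P g.
exists (2 * (complex.Re `|a|) ^+ 2 * M + 2 * M') => A.
apply: (@le_trans _ _ (\sum_(i <- A)
  (2 * (complex.Re `|a|) ^+ 2 * nrm (f i) ^+ 2 + 2 * nrm (g i) ^+ 2))).
  by apply: ler_sum => i _; apply: (le_trans (sqr_nrmD_le _ _)); rewrite nrm_scale exprMn mulrA.
rewrite big_split /= -!mulr_sumr; apply: lerD.
  by apply: ler_wpM2l; [apply: mulr_ge0; rewrite ?sqr_ge0|exact: fM].
by apply: ler_wpM2l; [|exact: gM'].
Qed.

Definition l2_comb (a : R[i]) (f g : l2) : l2 := L2 (l2_lin a f g).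

Lemma l2_combE a (f g : l2) i : l2_comb a f g i = a *: f i + g i. Proof. by []. Qed.

Lemma l2_zero : exists M, l2_bound (fun i => 0 : H i) M.
Proof. by exists 0 => A; rewrite big1// => i _; rewrite nrm0 expr0n. Qed.
Definition l20 : l2 := L2 l2_zero.

Let add (f g : l2) := l2_comb 1 f g.
Let opp (f : l2) := l2_comb (-1) f l20.
Let scale a (f : l2) := l2_comb a f l20.

Let addA : associative add.
Proof. by move=> f g h; apply: l2_ext => i /=; rewrite !scale1r addrA. Qed.
Let addC : commutative add.
Proof. by move=> f g; apply: l2_ext => i /=; rewrite !scale1r addrC. Qed.
Let add0 : left_id l20 add.
Proof. by move=> f; apply: l2_ext => i /=; rewrite scale1r add0r. Qed.
Let addN : left_inverse l20 opp add.
Proof. by move=> f; apply: l2_ext => i /=; rewrite scale1r scaleN1r addr0 addNr. Qed.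
HB.instance Definition _ := GRing.isZmodule.Build l2 addA addC add0 addN.

Lemma l2DE (f g : l2) i : (f + g) i = f i + g i.
Proof. by rewrite -[f i]scale1r. Qed.
Lemma l2NE (f : l2) i : (- f) i = - f i.
Proof. by rewrite -scaleN1r -[RHS]addr0. Qed.

Let scaleA a b f : scale a (scale b f) = scale (a * b) f.
Proof. by apply: l2_ext => i /=; rewrite !addr0 scalerA. Qed.
Let scale1 : left_id 1 scale.
Proof. by move=> f; apply: l2_ext => i /=; rewrite addr0 scale1r. Qed.
Let scaleE a f i : scale a f i = a *: f i.
Proof. by rewrite l2_combE addr0. Qed.
Let scaleDr : right_distributive scale +%R.
Proof. by move=> a f g; apply: l2_ext => i; rewrite l2DE !scaleE l2DE scalerDr. Qed.
Let scaleDl f : {morph scale^~ f : a b / a + b}.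
Proof. by move=> a b; apply: l2_ext => i; rewrite l2DE !scaleE scalerDl. Qed.
HB.instance Definition _ := GRing.Zmodule_isLmodule.Build R[i] l2 scaleA scale1 scaleDr scaleDl.

Lemma l2ZE a (f : l2) i : (a *: f) i = a *: f i.
Proof. by rewrite -[RHS]addr0. Qed.

Definition sqnorm (f : l2) : R := rsum (fun i => nrm (f i) ^+ 2).

Lemma sqnormP (f : l2) : [/\ rsums (fun i => nrm (f i) ^+ 2) (sqnorm f),
  forall M, l2_bound f M -> sqnorm f <= M & l2_bound f (sqnorm f)].
Proof.
have f0 i : 0 <= nrm (f i) ^+ 2 by rewrite sqr_ge0.
have [M fM] := l2P f; have [c [fc _ cf]] := rsums_ge0 f0 fM.
rewrite /sqnorm (rsumE fc); split=> // M' fM'.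
by have [d [fd dM _]] := rsums_ge0 f0 fM'; rewrite (rsums_unique fc fd).
Qed.

Lemma sqnorm_ge0 f : 0 <= sqnorm f.
Proof. by have [_ _ /(_ fset0)] := sqnormP f; rewrite big_seq_fset0. Qed.

Lemma sqnorm_coord (f : l2) i : nrm (f i) ^+ 2 <= sqnorm f.
Proof. by have [_ _ /(_ [fset i]%fset)] := sqnormP f; rewrite big_seq_fset1. Qed.

Lemma sqnorm_eq0 f : sqnorm f = 0 -> f = 0.
Proof.
move=> f0; apply: l2_ext => i; apply: nrm_eq0; apply/eqP.
by rewrite -sqrf_eq0 eq_le sqr_ge0 -f0 sqnorm_coord.
Qed.

Lemma rsums_scale k (a : I -> R) c : rsums a c -> rsums (fun i => k * a i) (k * c).
Proof.
move=> ac; have -> : (fun i => k * a i) = (fun i => (k - 1) * a i + a i).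
  by apply/funext => i; ring.
by have -> : k * c = (k - 1) * c + c; [ring|exact: rsums_lin].
Qed.

Lemma sqnormZ a f : sqnorm (a *: f) = (complex.Re `|a|) ^+ 2 * sqnorm f.
Proof.
have [fc _ _] := sqnormP f; apply: rsumE.
have -> : (fun i => nrm ((a *: f) i) ^+ 2) = (fun i => (complex.Re `|a|) ^+ 2 * nrm (f i) ^+ 2).
  by apply/funext => i; rewrite l2ZE nrm_scale exprMn.
exact: rsums_scale.
Qed.

(** Summing |x + y|^2 <= (1 + t) |x|^2 + (1 + 1/t) |y|^2 over the coordinates and
taking t = |g| / |f| gives Minkowski's inequality. *)
Lemma sqrt_sqnormD (f g : l2) :
  Num.sqrt (sqnorm (f + g)) <= Num.sqrt (sqnorm f) + Num.sqrt (sqnorm g).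
Proof.
have [f0|f0] := eqVneq (sqnorm f) 0.
  by rewrite f0 sqrtr0 (sqnorm_eq0 f0) !add0r.
have [g0|g0] := eqVneq (sqnorm g) 0.
  by rewrite g0 sqrtr0 (sqnorm_eq0 g0) !addr0.
set p := Num.sqrt (sqnorm f); set q := Num.sqrt (sqnorm g).
have p0 : 0 < p by rewrite sqrtr_gt0 lt_def f0 sqnorm_ge0.
have q0 : 0 < q by rewrite sqrtr_gt0 lt_def g0 sqnorm_ge0.
have fp : sqnorm f = p ^+ 2 by rewrite sqr_sqrtr// sqnorm_ge0.
have gq : sqnorm g = q ^+ 2 by rewrite sqr_sqrtr// sqnorm_ge0.
rewrite -ler_sqr ?nnegrE ?addr_ge0 ?sqrtr_ge0// sqr_sqrtr ?sqnorm_ge0//.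
have [_ le_sqnorm _] := sqnormP (f + g); apply: le_sqnorm => A.
have [_ _ fA] := sqnormP f; have [_ _ gA] := sqnormP g.
(* This t makes the two weighted sums add up to (p + q)^2. *)
pose t := q / p; have t0 : 0 < t by rewrite divr_gt0.
apply: (@le_trans _ _ (\sum_(i <- A) ((1 + t) * nrm (f i) ^+ 2 + (1 + t^-1) * nrm (g i) ^+ 2))).
  apply: ler_sum => i _; rewrite l2DE.
  have := nrmD (f i) (g i).
  move: (nrm_ge0 (f i)) (nrm_ge0 (g i)) (nrm_ge0 (f i + g i)).
  move: (nrm (f i)) (nrm (g i)) (nrm (f i + g i)) => x y z x0 y0 z0 zxy.
  apply: (@le_trans _ _ ((x + y) ^+ 2)); first by rewrite ler_sqr// nnegrE addr_ge0.
  rewrite -subr_ge0 (_ : _ - _ = t^-1 * (t * x - y) ^+ 2); last by field; rewrite gt_eqF.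
  by rewrite mulr_ge0 ?sqr_ge0// invr_ge0 ltW.
rewrite big_split /= -!mulr_sumr.
have -> : (p + q) ^+ 2 = (1 + t) * sqnorm f + (1 + t^-1) * sqnorm g.
  by rewrite fp gq /t; field; rewrite !gt_eqF.
have t0' := ltW t0.
apply: lerD; first by apply: ler_wpM2l; [rewrite addr_ge0|exact: fA].
by apply: ler_wpM2l; [rewrite addr_ge0 ?invr_ge0|exact: gA].
Qed.

Let norm (f : l2) : R[i] := (Num.sqrt (sqnorm f))%:C.
Let normD f g : norm (f + g) <= norm f + norm g.
Proof. by rewrite /norm -rmorphD lecR sqrt_sqnormD. Qed.
Let normZ (a : R[i]) f : norm (a *: f) = `|a| * norm f.
Proof.
rewrite /norm sqnormZ sqrtrM ?sqr_ge0// rmorphM; congr (_ * _).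
have /complex_realP[r ar] : `|a| \is Num.real by rewrite ger0_real.
by rewrite ar /= sqrtr_sqr ger0_norm// -ler0c -ar.
Qed.
Let norm_eq0 f : norm f = 0 -> f = 0.
Proof.
move=> /complexI/eqP; rewrite sqrtr_eq0 => f0; apply: sqnorm_eq0.
by apply/le_anti; rewrite f0 sqnorm_ge0.
Qed.
HB.instance Definition _ :=
  @Lmodule_isNormed.Build R[i] l2 norm normD normZ norm_eq0.

Lemma l2_normE (f : l2) : `|f| = (Num.sqrt (sqnorm f))%:C. Proof. by []. Qed.

Lemma l2_coord_norm (f : l2) i : `|f i| <= `|f|.
Proof.
rewrite l2_normE nrmE lecR -ler_sqr ?nnegrE ?nrm_ge0 ?sqrtr_ge0//.
by rewrite sqr_sqrtr ?sqnorm_ge0// sqnorm_coord.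
Qed.

Let complete (F : set_system l2) : ProperFilter F -> cauchy F -> cvg F.
Proof.
move=> FF /cauchy_ballP Fc.
have cv i : cvg ((fun f : l2 => f i) @ F).
  apply: cauchy_cvg; apply/cauchy_ballP => e e0.
  have [[A B] /= [FA FB] AB] := Fc e e0.
  exists ((fun f : l2 => f i) @` A, (fun f : l2 => f i) @` B) => /=.
    by split; [apply: filterS FA => x Ax|apply: filterS FB => x Bx]; exists x.
  move=> [_ _]/= [[x Ax <-] [y By <-]].
  have := AB (x, y) (conj Ax By).
  rewrite -!ball_normE /= /ball_/=; apply: le_lt_trans.
  by have := l2_coord_norm (x - y) i; rewrite l2DE l2NE.
have ex i : exists l : H i, (fun f : l2 => f i) @ F --> l by have /cvg_ex[l Fl] := cv i; exists l.
pose a i : H i := projT1 (cid (ex i)).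
have Fa i : (fun f : l2 => f i) @ F --> a i by exact: (projT2 (cid (ex i))).
have near_fin (e : R) (A : {fset I}) : 0 < e ->
    F [set f : l2 | \sum_(i <- A) nrm (f i - a i) ^+ 2 <= e].
  move=> e0; pose k := e / #|` A|.+1%:R; have k0 : 0 < k by rewrite divr_gt0.
  (* Cauchyness gives convergence of each coordinate, hence of any finite number
     of them at once; the bound e is shared between the indices in A. *)
  have near1 i : F [set f : l2 | nrm (f i - a i) ^+ 2 <= k].
    have r0 : 0 < (Num.sqrt k)%:C by rewrite ltcR sqrtr_gt0.
    have /cvgrPdist_lt/(_ _ r0) := Fa i; apply: filterS => f /=.
    rewrite distrC nrmE ltcR => fk; rewrite -[k]sqr_sqrtr ?(ltW k0)//.
    by rewrite ler_sqr ?nnegrE ?nrm_ge0 ?sqrtr_ge0// ltW.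
  have : F [set f : l2 | forall i, i \in A -> nrm (f i - a i) ^+ 2 <= k].
    have := @filter_bigI _ _ A (fun i => [set f : l2 | nrm (f i - a i) ^+ 2 <= k]) F FF.
    by move=> /(_ (fun i _ => near1 i)); apply: filterS => f fk i iA; exact: fk.
  apply: filterS => f fk.
  apply: (@le_trans _ _ (\sum_(i <- A) k)).
    by rewrite big_seq [leRHS]big_seq; apply: ler_sum => i /fk.
  rewrite big_const_seq count_predT iter_addr_0 -/(#|` A|).
  have -> : e = k *+ #|` A|.+1 by rewrite -mulr_natr divfK// pnatr_eq0.
  by rewrite mulrS lerDr ltW.
(* The bound is uniform in the finite set of coordinates: f is close to some g in
   the Cauchy set, which is close to the limit a on the coordinates at hand. *)
have est (e : R) : 0 < e -> exists2 S, F S & forall f, S f ->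
    l2_bound (fun i => f i - a i) (4 * e ^+ 2).
  move=> e0; have e0' : 0 < e%:C by rewrite ltcR.
  have [[A B] /= [FA FB] AB] := Fc _ e0'.
  exists A => // f Af C.
  have [g [Bg gC]] := filter_ex (filterI FB (near_fin (e ^+ 2) C (exprn_gt0 _ e0))).
  have := AB (f, g) (conj Af Bg); rewrite -ball_normE /= /ball_ l2_normE ltcR => fg.
  have [_ _ /(_ C)] := sqnormP (f - g).
  have : sqnorm (f - g) <= e ^+ 2.
    by rewrite -(sqr_sqrtr (sqnorm_ge0 (f - g))) ler_sqr ?nnegrE ?sqrtr_ge0// ltW.
  move=> fg2 fgC; apply: (@le_trans _ _ (\sum_(i <- C)
    (2 * nrm ((f - g) i) ^+ 2 + 2 * nrm (g i - a i) ^+ 2))).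
    apply: ler_sum => i _; apply: (le_trans _ (sqr_nrmD_le _ _)).
    by rewrite l2DE l2NE addrA subrK.
  rewrite big_split /= -!mulr_sumr; move: gC => /= gC; move: gC fgC fg2.
  move: (\sum_(i <- _) _) (\sum_(i <- _) _) (sqnorm _) (e ^+ 2) => p q r s.
  lra.
have aP : exists M, l2_bound a M.
  have [S FS SP] := est 1 ltr01; have [f Sf] := filter_ex FS.
  have [_ _ fB] := sqnormP f; exists (2 * sqnorm f + 2 * (4 * 1 ^+ 2)) => A.
  apply: (@le_trans _ _ (\sum_(i <- A) (2 * nrm (f i) ^+ 2 + 2 * nrm (f i - a i) ^+ 2))).
    apply: ler_sum => i _; rewrite nrmB; apply: (le_trans _ (sqr_nrmD_le _ _)).
    by rewrite addrC subrK.
  have := fB A; have := SP f Sf A.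
  rewrite big_split /= -!mulr_sumr.
  move: (\sum_(i <- _) _) (\sum_(i <- _) _) (sqnorm _) (1 ^+ 2) => p q r s.
  lra.
pose l := L2 aP.
apply/cvg_ex; exists l; apply/cvgrPdist_lt => e /realeps[r r0 ->].
have [S FS SP] := est (r / 4) (divr_gt0 r0 (ltr0n R 4)).
apply: filterS FS => f Sf; rewrite distrC l2_normE ltcR.
have [_ le_sqnorm _] := sqnormP (f - l).
have fl : sqnorm (f - l) <= (r / 2) ^+ 2.
  apply: le_sqnorm => A; apply: le_trans (_ : 4 * (r / 4) ^+ 2 <= _); last first.
    by rewrite le_eqVlt; apply/orP; left; apply/eqP; field.
  apply: le_trans (SP f Sf A).
  by apply: ler_sum => i _; rewrite l2DE l2NE.
have r2 : 0 < r / 2 by rewrite divr_gt0.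
apply: (@le_lt_trans _ _ (r / 2)); last by lra.
by rewrite -ler_sqr ?nnegrE ?sqrtr_ge0 ?(ltW r2)// sqr_sqrtr ?sqnorm_ge0.
Qed.
HB.instance Definition _ := Uniform_isComplete.Build l2 complete.

(** The real and imaginary parts of the inner product are summed separately; the
real part converges by polarization. *)
Definition l2_re (f g : l2) := rsum (fun i => complex.Re (inner (f i) (g i))).
Definition l2_im (f g : l2) := rsum (fun i => complex.Im (inner (f i) (g i))).

Lemma l2_reP (f g : l2) : rsums (fun i => complex.Re (inner (f i) (g i))) (l2_re f g).
Proof.
have [fgc _ _] := sqnormP (f + g); have [fc _ _] := sqnormP f; have [gc _ _] := sqnormP g.
have := rsums_scale 2^-1 (rsums_lin (-1) gc (rsums_lin (-1) fc fgc)).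
set a := (a in rsums a _); set c := (c in rsums _ c) => ac.
have -> : (fun i => complex.Re (inner (f i) (g i))) = a.
  by apply/funext => i; rewrite /a l2DE sqr_nrmD; field.
suff -> : l2_re f g = c by [].
rewrite /l2_re (_ : (fun i => _) = a) ?(rsumE ac)//.
by apply/funext => i; rewrite /a l2DE sqr_nrmD; field.
Qed.

(** The imaginary part of <f, g> is the real part of <- i f, g>. *)
Lemma l2_imP (f g : l2) : rsums (fun i => complex.Im (inner (f i) (g i))) (l2_im f g).
Proof.
have e : (fun i => complex.Im (inner (f i) (g i))) =
         (fun i => complex.Re (inner (((- 'i%C) *: f) i) (g i))).
  apply/funext => i; rewrite l2ZE innerZl; case: (inner _ _) => u v /=; simpc.
  by rewrite /=; ring.
by rewrite /l2_im e; exact: l2_reP.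
Qed.

Let ip (f g : l2) : R[i] := Complex (l2_re f g) (l2_im f g).

Let ipE (f g : l2) (a b : R) : rsums (fun i => complex.Re (inner (f i) (g i))) a ->
  rsums (fun i => complex.Im (inner (f i) (g i))) b -> ip f g = Complex a b.
Proof. by move=> /rsumE fa /rsumE fb; rewrite /ip /l2_re /l2_im fa fb. Qed.

Let ip_norm (f : l2) : ip f f = `|f| ^+ 2.
Proof.
rewrite l2_normE -rmorphXn /= sqr_sqrtr ?sqnorm_ge0//.
have [fc _ _] := sqnormP f; apply: ipE.
  have -> : (fun i => complex.Re (inner (f i) (f i))) = (fun i => nrm (f i) ^+ 2).
    by apply/funext => i; rewrite inner_nrm.
  exact: fc.
have -> : (fun i => complex.Im (inner (f i) (f i))) = (fun i => 0 * nrm (f i) ^+ 2).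
  by apply/funext => i; rewrite inner_nrm mul0r.
by have := rsums_scale 0 fc; rewrite mul0r.
Qed.

Let ip_herm (f g : l2) : ip f g = (-1) ^+ false * (ip g f)^*%R.
Proof.
rewrite mul1r; apply: ipE.
  have -> : (fun i => complex.Re (inner (f i) (g i))) = (fun i => complex.Re (inner (g i) (f i))).
    by apply/funext => i; rewrite innerC; case: (inner _ _).
  exact: l2_reP.
have -> : (fun i => complex.Im (inner (f i) (g i))) = (fun i => (-1) * complex.Im (inner (g i) (f i))).
  by apply/funext => i; rewrite innerC mulN1r; case: (inner _ _).
by have := rsums_scale (-1) (l2_imP g f); rewrite mulN1r.
Qed.

Let ip_lin (a : R[i]) (f f' g : l2) : ip (a *: f + f') g = a * ip f g + ip f' g.
Proof.
case: a => p q.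
(* Real and imaginary parts of (p + i q) <f, g> + <f', g>. *)
have hr := rsums_lin p (l2_reP f g) (rsums_lin (- q) (l2_imP f g) (l2_reP f' g)).
have hi := rsums_lin p (l2_imP f g) (rsums_lin q (l2_reP f g) (l2_imP f' g)).
have -> : ip ((p +i* q) *: f + f') g =
    (p * l2_re f g + (- q * l2_im f g + l2_re f' g)) +i*
    (p * l2_im f g + (q * l2_re f g + l2_im f' g)).
  apply: ipE.
    congr (rsums _ _) : hr; apply/funext => i; rewrite l2DE l2ZE innerDl innerZl.
    by case: (inner _ _) => u v; case: (inner _ _) => u' v' /=; ring.
  congr (rsums _ _) : hi; apply/funext => i; rewrite l2DE l2ZE innerDl innerZl.
  by case: (inner _ _) => u v; case: (inner _ _) => u' v' /=; ring.
by rewrite /ip; simpc; congr (_ +i* _); ring.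
Qed.

Let ip_bil : bilinear_for *%R (conjC \; *%R) ip.
Proof.
split=> [g a f f'|f a g g']; first exact: ip_lin.
by rewrite ip_herm /= mul1r ip_lin rmorphD rmorphM /= !(ip_herm f) /= !mul1r.
Qed.
HB.instance Definition _ := bilinear_isBilinear.Build _ _ _ _ _ _ ip ip_bil.
HB.instance Definition _ := isHermitianSesquilinear.Build _ _ _ _ ip ip_herm.
Let ip_pos (x : l2) : x != 0 -> 0 < ip x x.
Proof. by move=> x0; rewrite ip_norm exprn_gt0// normr_gt0. Qed.
HB.instance Definition _ := isDotProduct.Build _ _ ip ip_pos.
HB.instance Definition _ := CompleteNormedModule_isHilbert.Build R l2 ip_norm.
End L2.

(** * Hilbert direct sums of tuples *)

(** Invariance of the range under the adjoints as well makes it commute with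
everything. *)
Lemma central_of_ran (R : realType) (N : nat) (A B : cdd_tuple R N) (W : hom A B) :
  isometric W -> (forall (T : hom B B) x, W (adj W (T (W x))) = T (W x)) -> central W.
Proof.
move=> iW key; split=> // T x; apply: inner_ext => z.
rewrite [LHS](adjE W) adjE' adjE -(key (adj T)).
by rewrite -(adjE' W) -(adjE W) -(adjE T) -(adjE' W) -(adjE W) key.
Qed.

Section HilbertSum.
Context {R : realType} {N : nat} {I : choiceType} (X : I -> cdd_tuple R N).

Definition lsum := l2 (fun i => space (X i)).

Lemma inner_l2 (f g : lsum) (c : R[i]) :
  rsums (fun i => complex.Re (inner (f i) (g i))) (complex.Re c) ->
  rsums (fun i => complex.Im (inner (f i) (g i))) (complex.Im c) -> inner f g = c.
Proof.
move=> fr fi; apply/eqP; rewrite eq_complex; apply/andP; split; apply/eqP.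
  exact: rsums_unique (l2_reP f g) fr.
exact: rsums_unique (l2_imP f g) fi.
Qed.

Definition spike i (x : space (X i)) : forall k, space (X k) :=
  eqtype.dfwith (fun k => 0 : space (X k)) x.

Lemma spike_bound i (x : space (X i)) : exists M, l2_bound (spike x) M.
Proof.
exists (nrm x ^+ 2) => A.
apply: (@le_trans _ _ (\sum_(k <- (i |` A)%fset) nrm (spike x k) ^+ 2)).
  by apply: sum_fset_le => [k|]; [exact: sqr_ge0|exact: fsubsetU1].
rewrite (big_fsetD1 i) ?fset1U1//= /spike eqtype.dfwith_in big1_seq ?addr0// => k /andP[_].
by rewrite !inE => /andP[ki _]; rewrite eqtype.dfwith_out 1?eq_sym// nrm0 expr0n.
Qed.

Definition lsum_spike i (x : space (X i)) : lsum := L2 (spike_bound x).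

Lemma inner_lsum_spike i (x : space (X i)) (f : lsum) : inner (lsum_spike x) f = inner x (f i).
Proof.
have e : inner x (f i) = inner (lsum_spike x i) (f i) by rewrite /= /spike eqtype.dfwith_in.
have z k : k != i -> inner (lsum_spike x k) (f k) = 0.
  by move=> ki; rewrite /= /spike eqtype.dfwith_out 1?eq_sym// inner0l.
by rewrite e; apply: inner_l2; apply: rsums_one => k /z ->.
Qed.

Definition lsum_graph j : set (lsum * lsum) :=
  [set p : lsum * lsum | forall i, graph (X i j) (p.1 i, p.2 i)].

Lemma lsum_submod j : submod_closed [in lsum_graph j].
Proof.
split; first by apply/mem_set => i; exact: graph0.
move=> a [f g] [f' g'] /set_mem fg /set_mem fg'; apply/mem_set => i.
change (graph (X i j) ((a *: f + f' : lsum) i, (a *: g + g' : lsum) i)).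
by rewrite !l2DE !l2ZE; exact: graph_lin.
Qed.

Lemma lsum_fun j (f g g' : lsum) : lsum_graph j (f, g) -> lsum_graph j (f, g') -> g = g'.
Proof. by move=> fg fg'; apply: l2_ext => i; exact: graph_fun (fg i) (fg' i). Qed.

Definition lsum_op j : operator lsum := Operator (lsum_submod j) (@lsum_fun j).

Lemma lsum_spike_graph i j (x y : space (X i)) :
  graph (X i j) (x, y) -> graph (lsum_op j) (lsum_spike x, lsum_spike y).
Proof.
move=> xy k /=; rewrite /spike; have [ki|ki] := eqVneq i k.
  by case: k / ki; rewrite !eqtype.dfwith_in.
by rewrite !eqtype.dfwith_out//; exact: graph0.
Qed.

(** The graph is closed coordinatewise. A vector orthogonal to the domain is
orthogonal to all the families with a single nonzero term in the domain of a
summand, so each of its coordinates vanishes. *)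
Lemma lsum_cdd j : closed_densely_defined (lsum_op j).
Proof.
split.
  apply/closed_prod_nrm => f g fgC i /=.
  have [+ _] := cdd_opP (X i) j; move/closed_prod_nrm; apply => e /fgC[f' [g' [fg' ff' gg']]].
  have coord (h h' : lsum) : nrm (h - h') < e -> nrm (h i - h' i) < e.
    move=> hh'; apply: le_lt_trans hh'; rewrite -lecR -!nrmE.
    by have := l2_coord_norm (h - h') i; rewrite l2DE l2NE.
  by exists (f' i), (g' i); split; [exact: fg'|exact: coord|exact: coord].
apply: submod_dense; first exact: domain_submod.
move=> f f0; apply: l2_ext => i.
apply: (dense_perp (cdd_opP (X i) j).2) => u [v uv].
apply: inner_eq0C; rewrite -inner_lsum_spike; apply/inner_eq0C/f0.
by exists (lsum_spike v); exact: lsum_spike_graph.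
Qed.

Definition hilbert_sum : cdd_tuple R N := CDDTuple (cdd_op := OpTuple lsum_op) lsum_cdd.

Definition summand i : hom (X i) hilbert_sum :=
  @Hom R N (X i) hilbert_sum (@lsum_spike i) (fun f => f i) (@inner_lsum_spike i)
    (@lsum_spike_graph i)
    (fun j f g fg => fg i).

Lemma summandK i : isometric (summand i).
Proof. by move=> x; rewrite -[LHS]/(spike x i) /spike eqtype.dfwith_in. Qed.

Lemma summand_orth i k x : i != k -> adj (summand k) (summand i x) = 0.
Proof. by move=> ik; rewrite -[LHS]/(spike x k) /spike eqtype.dfwith_out. Qed.

Lemma hilbert_sum_total f : (forall i, adj (summand i) f = 0) -> f = 0.
Proof. by move=> f0; apply: l2_ext => i; exact: f0. Qed.

(** Orthogonal copies of the summands in Y pair with the summands themselves. *)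
Lemma hilbert_sum_glue (Y : cdd_tuple R N) (V : forall i, hom (X i) Y) :
  (forall i, isometric (V i)) -> (forall i k x, i != k -> adj (V k) (V i x) = 0) ->
  exists W : hom hilbert_sum Y, [/\ isometric W, forall i x, W (summand i x) = V i x &
    forall i x, adj W (V i x) = summand i x].
Proof.
move=> iV oV; apply: pairing_isometric => [i k x|]; last exact: hilbert_sum_total.
have [->|ik] := eqVneq i k; first by rewrite summandK iV.
by rewrite summand_orth 1?eq_sym// oV// eq_sym.
Qed.

(** A self-intertwiner T of Y preserves the range of each V i, hence the closed
span of these ranges. *)
Lemma hilbert_sum_glue_central (Y : cdd_tuple R N) (V : forall i, hom (X i) Y)
    (W : hom hilbert_sum Y) :
  (forall i, central (V i)) -> isometric W -> (forall i x, W (summand i x) = V i x) ->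
  central W.
Proof.
move=> cV iW WV.
have key (T : hom Y Y) f : W (adj W (T (W f))) = T (W f).
  apply/eqP; rewrite -subr_eq0; apply/eqP.
  pose Q := hlincomb (-1) (hcomp W (adj W)) (hid Y).
  have QE y : Q y = y - W (adj W y) by rewrite hlincombE rmorphN rmorph1 scaleN1r addrC.
  pose S := hcomp Q (hcomp T W).
  suff S0 : S f = 0 by rewrite -opprB -QE; move: S0; rewrite /S !hcompE => ->; rewrite oppr0.
  apply: inner_ext => z; rewrite inner0l adjE.
  rewrite (_ : adj S z = 0) ?inner0r//; apply: hilbert_sum_total => i.
  apply: inner_ext => x; rewrite inner0l !adjE' /S !hcompE WV.
  rewrite -(central_ran (cV i)) QE -WV iW subrr inner0r//.
exact: central_of_ran.
Qed.
End HilbertSum.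

(** * The sum of the fresh parts of a family *)

(** The order decides which member of a family claims a piece that several of
them share. *)
Lemma exists_wf_total (T : eqType) : exists lt : T -> T -> Prop,
  (forall i k, i != k -> lt i k \/ lt k i) /\
  (forall P : T -> Prop, (forall b, (forall c, lt c b -> P c) -> P b) -> forall b, P b).
Proof.
have [r wo] := well_ordering_principle T.
have rr x : r x x.
  have [|z [[zx zmin] _]] := wo (pred1 x); first by exists x; rewrite inE.
  by have := zmin x; rewrite inE eqxx => /(_ isT); move: zx; rewrite inE => /eqP ->.
exists (fun c b => r c b /\ c != b); split=> [i k ik|P IH b].
  have [|z [[zik zmin] _]] := wo (pred2 i k); first by exists i; rewrite inE /= eqxx.
  move: zik (zmin i) (zmin k); rewrite !inE /= !eqxx orbT => zik /(_ isT) zi /(_ isT) zk.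
  by case/orP: zik => /eqP e; rewrite e in zi zk; [left|right]; rewrite // eq_sym.
apply: contrapT => Pb.
pose A := [pred x | `[< ~ P x >]].
have AP y : (y \in A) = `[< ~ P y >] by [].
have [|z [[zA zmin] _]] := wo A; first by exists b; rewrite AP; apply/asboolP.
move: zA; rewrite AP => /asboolP; apply; apply: IH => c [rcz cz].
apply: contrapT => Pc.
have rzc : r z c by apply: zmin; rewrite AP; apply/asboolP.
have [|w [_ wuniq]] := wo (pred2 c z); first by exists c; rewrite inE /= eqxx.
have wc : w = c.
  apply: wuniq; split; first by rewrite inE /= eqxx.
  by move=> y; rewrite inE /= => /orP[/eqP ->|/eqP ->].
have wz : w = z.
  apply: wuniq; split; first by rewrite inE /= eqxx orbT.
  by move=> y; rewrite inE /= => /orP[/eqP ->|/eqP ->].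
by move: cz; rewrite -wc -wz eqxx.
Qed.

Section FreshSum.
Context {R : realType} {N : nat} {I : choiceType} (X : I -> cdd_tuple R N).
Variable lt : I -> I -> Prop.
Hypothesis lt_total : forall i k, i != k -> lt i k \/ lt k i.
Hypothesis lt_ind : forall P : I -> Prop,
  (forall b, (forall c, lt c b -> P c) -> P b) -> forall b, P b.

Definition earlier a := {p : {b : I & hom (X a) (X b)} | lt (projT1 p) a}.

Definition fresh_csub a :=
  equalizer (fun p : earlier a => projT2 (proj1_sig p)) (fun p => hzero _ _).

Lemma fresh_csubP a x : csub_set (fresh_csub a) x <->
  forall b, lt b a -> forall T : hom (X a) (X b), T x = 0.
Proof.
rewrite equalizerP; split=> [x0 b ba T|x0 [[b T] /= ba]]; last exact: x0.
exact: (x0 (exist _ (existT _ b T) ba)).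
Qed.

Lemma fresh_red a : red (fresh_csub a). Proof. exact: equalizer_red. Qed.

(** The part of X a which is disjoint from all the earlier members of the
family. *)
Definition fresh a := sub_tuple (@fresh_red a).
Definition fincl a : hom (fresh a) (X a) := incl (@fresh_red a).

Lemma finclK a : isometric (fincl a). Proof. exact: inclK. Qed.

Lemma fincl_kill a b (T : hom (X a) (X b)) x : lt b a -> T (fincl a x) = 0.
Proof. by move=> ba; apply: (fresh_csubP (a := a) _).1 ba T; exact: csub_valK. Qed.

Lemma fincl_ran a x : (forall b, lt b a -> forall T : hom (X a) (X b), T x = 0) ->
  fincl a (adj (fincl a) x) = x.
Proof. by move=> /fresh_csubP Ex; rewrite incl_adj proj_id. Qed.

(** Composing with a self-intertwiner of X a preserves the set of intertwiners to
earlier members, hence also their common kernel. *)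
Lemma fincl_central a : central (fincl a).
Proof.
apply: central_of_ran; first exact: finclK.
by move=> T x; apply: fincl_ran => b ba S; exact: (fincl_kill (hcomp S T)).
Qed.

(** An intertwiner from a fresh part to an earlier one extends to one from X a to
an earlier member, which kills the fresh part; otherwise take adjoints. *)
Lemma fresh_hom0 a b (T : hom (fresh a) (fresh b)) x : a != b -> T x = 0.
Proof.
have kill c d (S : hom (fresh c) (fresh d)) y : lt d c -> S y = 0.
  move=> dc; have := fincl_kill (hcomp (fincl d) (hcomp S (adj (fincl c)))) y dc.
  by rewrite !hcompE finclK => /(congr1 (adj (fincl d))); rewrite finclK hom0.
move=> /lt_total[ab|/kill//].
by rewrite -(adjK T); apply: hom0_adj => y; exact: kill.
Qed.

Definition fresh_sum := hilbert_sum fresh.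

(** Restricted to the fresh parts, the embeddings have orthogonal ranges, because an
intertwiner between two fresh parts is 0. *)
Lemma fresh_sum_univ (Y : cdd_tuple R N) (V : forall a, hom (X a) Y) :
  (forall a, isometric (V a)) ->
  exists W : hom fresh_sum Y, isometric W /\ ((forall a, central (V a)) -> central W).
Proof.
move=> iV; have [|i k x ik|W [iW WE _]] := hilbert_sum_glue (V := fun a => hcomp (V a) (fincl a)).
- by move=> a; apply: isometric_comp; [exact: iV|exact: finclK].
- exact: (fresh_hom0 (hcomp (adj (hcomp (V k) (fincl k))) (hcomp (V i) (fincl i)))).
- exists W; split=> // cV; apply: (hilbert_sum_glue_central _ iW WE) => a.
  by apply: central_comp; [exact: cV|exact: fincl_central].
Qed.

(** A self-intertwiner of the sum has no off-diagonal entries. *)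
Lemma summand_central a : central (summand fresh a).
Proof.
apply: central_of_ran; first exact: summandK.
move=> T x; apply/eqP; rewrite -subr_eq0; apply/eqP/hilbert_sum_total => k.
rewrite homB; have [<-|ak] := eqVneq a k; first by rewrite summandK subrr.
have := fresh_hom0 (hcomp (adj (summand fresh k)) (hcomp T (summand fresh a))) x ak.
by rewrite !hcompE summand_orth// => ->; rewrite subrr.
Qed.

Record strong_bound (A B : cdd_tuple R N) := StrongBound {
  sb_top : cdd_tuple R N ; sb_left : hom A sb_top ; sb_right : hom B sb_top ;
  sb_left_central : central sb_left ; sb_right_central : central sb_right }.

Section Embedding.
Variable a : I.
Variable c : forall b, strong_bound (X a) (X b).
Let V b := sb_left (c b).
Let W b := sb_right (c b).
Let Wf b := hcomp (W b) (fincl b).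
Let cV b : central (V b) := sb_left_central (c b).
Let cWf b : central (Wf b).
Proof. by apply: central_comp; [exact: sb_right_central|exact: fincl_central]. Qed.

(** The passage from the fresh part of X b to X a through their common bound. As both
ranges are central there, P b is a partial isometry, and its initial space X2 b is
the part that the fresh part of X b shares with X a. *)
Let P b : hom (fresh b) (X a) := hcomp (adj (V b)) (Wf b).

Let PE b x : P b x = adj (V b) (Wf b x). Proof. by []. Qed.
Let PE' b x : adj (P b) x = adj (Wf b) (V b x). Proof. by []. Qed.

Let PPP b x : adj (P b) (P b (adj (P b) x)) = adj (P b) x.
Proof.
rewrite !PE' PE; have := central_ran (cV b) (hcomp (Wf b) (adj (Wf b))) x.
by rewrite !hcompE => ->; rewrite (centralK (cWf b)).
Qed.

Let E b := equalizer (fun _ : unit => hcomp (adj (P b)) (P b)) (fun _ => hid (fresh b)).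
Let rE b : red (E b). Proof. exact: equalizer_red. Qed.
Let EP b x : csub_set (E b) x <-> adj (P b) (P b x) = x.
Proof. by rewrite equalizerP; split=> [/(_ tt)|? []]. Qed.
Let X2 b := sub_tuple (@rE b).
Let n b : hom (X2 b) (fresh b) := incl (@rE b).
Let nK b : isometric (n b). Proof. exact: inclK. Qed.
Let n_ran b x : adj (P b) (P b x) = x -> n b (adj (n b) x) = x.
Proof. by move=> /EP Ex; rewrite incl_adj proj_id. Qed.
Let n_in b x : adj (P b) (P b (n b x)) = n b x.
Proof. by apply/EP; exact: csub_valK. Qed.
Let n_central b : central (n b).
Proof.
apply: central_of_ran => // T x; apply: n_ran.
rewrite PE PE'.
have := centralC (cV b) (hcomp (Wf b) (hcomp T (adj (Wf b)))) (Wf b (n b x)).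
rewrite !hcompE (centralK (cWf b)) => ->; rewrite (centralK (cWf b)).
by rewrite -PE -PE' n_in.
Qed.

(** By induction on b, every intertwiner T : X a -> X b kills x: then T x is killed
by all intertwiners to earlier members, so it lies in the fresh part of X b,
but the component of T x there is determined by that of x in the part shared
with the fresh part of X b, which is 0. The case T = id gives x = 0. *)
Let kernel0 x : (forall b, adj (P b) x = 0) -> x = 0.
Proof.
move=> Px; suff /(_ a (hid _)) : forall b (T : hom (X a) (X b)), T x = 0 by [].
apply: lt_ind => b IH T.
have Tx : fincl b (adj (fincl b) (T x)) = T x.
  by apply: fincl_ran => d db S; exact: (IH d db (hcomp S T)).
rewrite -Tx; suff -> : adj (fincl b) (T x) = 0 by rewrite hom0.
have := centralC (cWf b) (hcomp (W b) (hcomp T (adj (V b)))) (V b x).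
rewrite !hcompE (centralK (cV b)) -PE' Px !hom0 => /(congr1 (adj (Wf b))).
by rewrite (centralK (cWf b)) hom0 adj_hcompE (centralK (sb_right_central (c b))).
Qed.

(** The pieces X2 b of X a shared with the fresh parts have dense span in X a by
[kernel0], so X a is their Hilbert sum; each of them is also central in the
fresh part of X b, hence in the sum of the fresh parts. *)
Lemma fresh_sum_embed : exists U : hom (X a) fresh_sum, central U.
Proof.
have [||G1 [iG1 G1E G1E']] := hilbert_sum_glue (V := fun b => hcomp (P b) (n b)).
- by move=> b x; rewrite adj_hcompE hcompE n_in nK.
- move=> i k x ik; rewrite adj_hcompE hcompE.
  by rewrite -[adj _ (P i _)]/(hcomp (adj (P k)) (P i) _) (fresh_hom0 _ _ ik) hom0.
have [||G2 [iG2 G2E _]] := hilbert_sum_glue (V := fun b => hcomp (summand fresh b) (n b)).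
- by move=> b; apply: isometric_comp; [exact: summandK|exact: nK].
- by move=> i k x ik; rewrite adj_hcompE hcompE summand_orth// hom0.
have cG2 : central G2.
  apply: (hilbert_sum_glue_central _ iG2 G2E) => b.
  by apply: central_comp; [exact: summand_central|exact: n_central].
exists (hcomp G2 (adj G1)); apply: central_comp => //.
apply: unitary_central; split; last exact: iG1.
move=> y; rewrite adjK; apply/esym/eqP; rewrite -subr_eq0; apply/eqP/kernel0 => b.
have dG1 z : adj (summand X2 b) (adj G1 z) = adj (n b) (adj (P b) z).
  by apply: inner_ext => w; rewrite !adjE' G1E.
have nP z : n b (adj (n b) (adj (P b) z)) = adj (P b) z by apply: n_ran; exact: PPP.
by rewrite -nP -dG1 homB iG1 subrr !hom0.
Qed.
End Embedding.
End FreshSum.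

(** * Bounds for the two orders *)

Section Orders.
Context {R : realType} {N : nat}.
Implicit Types A B C : cdd_tuple R N.
Implicit Types X Y Z : ucdd R N.

Lemma ule_antisym X Y : ule X Y -> ule Y X -> X = Y.
Proof.
by move=> /uleP[V iV] /uleP[W iW]; apply/ucdd_eqP; exact: cantor_bernstein iV iW.
Qed.

Lemma sle_antisym X Y : sle X Y -> sle Y X -> X = Y.
Proof. by move=> /sle_ule XY /sle_ule YX; exact: ule_antisym. Qed.

Lemma hom_uclass_ule A Y (V : hom A (urepr Y)) : isometric V -> ule (uclass A) Y.
Proof.
move=> iV; have [U [iU _]] := uclass_repr A.
by apply/uleP; exists (hcomp V U); exact: isometric_comp.
Qed.

Lemma hom_uclass_sle A Y (V : hom A (urepr Y)) : central V -> sle (uclass A) Y.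
Proof.
move=> cV; have [U uU] := uclass_repr A.
by apply/sleP; exists (hcomp V U); apply: central_comp => //; exact: unitary_central.
Qed.

Lemma hom_sle_uclass X B (V : hom (urepr X) B) : central V -> sle X (uclass B).
Proof.
move=> cV; have [U uU] := uclass_repr B.
apply/sleP; exists (hcomp (adj U) V); apply: central_comp => //.
exact/unitary_central/unitary_adj.
Qed.

Lemma hom_ule_uclass X B (V : hom (urepr X) B) : isometric V -> ule X (uclass B).
Proof.
move=> iV; have [U [_ iU]] := uclass_repr B.
by apply/uleP; exists (hcomp (adj U) V); exact: isometric_comp.
Qed.

Lemma is_zeroP Z : is_zero Z <-> is_trivial (urepr Z).
Proof.
split=> [Z0|Z0 A]; first by apply/Z0; exact: members_urepr.
rewrite membersE; split=> [[U [iU iU']] x|A0].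
  by rewrite -(iU' x) (Z0 (adj U x)) hom0.
by exists (hzero _ _); split=> x; rewrite ?(Z0 x) ?(A0 x).
Qed.

Lemma uperp_sym X Y : uperp X Y -> uperp Y X.
Proof. by move=> XY [Z [Z0 ZY ZX]]; apply: XY; exists Z. Qed.

Lemma hom0_uperp X Y :
  (forall (T : hom (urepr X) (urepr Y)) x, T x = 0) -> uperp X Y.
Proof.
move=> T0 [Z [Z0 /uleP[V iV] /uleP[W iW]]]; apply: Z0; apply/is_zeroP => z.
by have := T0 (hcomp W (adj V)) (V z); rewrite hcompE iV -{2}[z]iW => ->; rewrite hom0.
Qed.

(** The contrapositive of [schur]: a nonzero contractive intertwiner produces a
nonzero common part. *)
Lemma uperp_hom0 X Y (T : hom (urepr X) (urepr Y)) :
  uperp X Y -> contractive T -> forall x, T x = 0.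
Proof.
move=> XY cT; apply: schur => // C V W iV iW x; apply: contrapT => x0.
apply: XY; exists (uclass C); split.
- move=> /is_zeroP C0; apply: x0; have [U [_ iU]] := uclass_repr C.
  by rewrite -[x]iU (C0 (adj U x)) hom0.
- exact: hom_uclass_ule iV.
- exact: hom_uclass_ule iW.
Qed.

(** The sum of the fresh parts, for a well-ordering of I. *)
Lemma fresh_sum_class (I : Type@{Hilbert.axioms_.u0}) (F : I -> ucdd R N) : exists J,
  [/\ forall Y, (forall i, ule (F i) Y) -> ule J Y,
      forall Y, (forall i, sle (F i) Y) -> sle J Y &
      (forall i k, F i <> F k -> ub_bounded sle (pair_set (F i) (F k))) ->
      forall i, sle (F i) J].
Proof.
have [lt [ltt lti]] := exists_wf_total {classic I}.
pose X (i : {classic I}) := urepr (F i).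
exists (uclass (fresh_sum X lt)); split=> [Y FY|Y FY|bF i].
- have V i := cid ((uleP (F i) Y).1 (FY i)).
  have [W [iW _]] := fresh_sum_univ ltt (X := X) (fun i => projT2 (V i)).
  exact: hom_uclass_ule iW.
- have V i := cid ((sleP (F i) Y).1 (FY i)).
  have [W [_ cW]] := fresh_sum_univ ltt (X := X) (fun i => (projT2 (V i)).1).
  apply: hom_uclass_sle (cW _) => a; exact: (projT2 (V a)).
have sb_top k : exists c : strong_bound (X i) (X k), True.
  have [e|ne] := pselect (F i = F k).
    rewrite /X -e; have uid := unitary_central (@unitary_id R N (urepr (F i))).
    by exists (StrongBound uid uid).
  have [Z ZF] := bF i k ne.
  have /sleP[V cV] : sle (F i) Z by apply: ZF; left.
  have /sleP[W cW] : sle (F k) Z by apply: ZF; right.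
  by exists (StrongBound cV cW).
have [U cU] := fresh_sum_embed ltt lti (fun k => projT1 (cid (sb_top k))).
exact: hom_sle_uclass cU.
Qed.

(** Each member of BB is a central part of J, and the intersection of these parts is
central. If X is below all of BB for one of the orders, then its copy in J lies in
every part by [isometric_sub_central], hence in the intersection. *)
Lemma exists_glb (BB : ucdd R N -> Prop) J : (exists X, BB X) ->
  (forall X, BB X -> sle X J) -> exists G, is_glb sle BB G /\ is_glb ule BB G.
Proof.
move=> [B0 BB0] BJ.
have V (i : {X | BB X}) := cid ((sleP (proj1_sig i) J).1 (BJ _ (proj2_sig i))).
pose v i := projT1 (V i); have cv i : central (v i) := projT2 (V i).
pose E := equalizer (fun i => hcomp (v i) (adj (v i))) (fun _ => hid (urepr J)).
have rE : red E by exact: equalizer_red.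
have EP x : csub_set E x <-> forall i, v i (adj (v i) x) = x by exact: equalizerP.
pose g := incl rE; have gK : isometric g by exact: inclK.
have g_in i x : v i (adj (v i) (g x)) = g x by move: i; apply/EP; exact: csub_valK.
have g_ran x : (forall i, v i (adj (v i) x) = x) -> g (adj g x) = x.
  by move=> /EP Ex; rewrite incl_adj proj_id.
have cg : central g.
  apply: central_of_ran => // T x; apply: g_ran => i.
  by rewrite (centralC (cv i)) g_in.
have lbs X : BB X -> sle (uclass (sub_tuple rE)) X.
  move=> BX; pose i : {X | BB X} := exist _ X BX.
  apply: (hom_uclass_sle (V := hcomp (adj (v i)) g)).
  by apply: central_factor; [exact: cg|exact: (cv i).1|exact: g_in].
exists (uclass (sub_tuple rE)); split; split=> //; last first.
- move=> X XB; have T (i : {X | BB X}) := cid ((uleP X (proj1_sig i)).1 (XB _ (proj2_sig i))).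
  pose i0 : {X | BB X} := exist _ B0 BB0.
  (* The copy of X in J, obtained through one member of BB. *)
  pose w := hcomp (v i0) (projT1 (T i0)).
  have iw : isometric w by apply: isometric_comp; [exact: (cv i0).1|exact: (projT2 (T i0))].
  have w_in x : g (adj g (w x)) = w x.
    by apply: g_ran => i; exact: (isometric_sub_central iw (cv i) (projT2 (T i))).
  apply: (hom_ule_uclass (V := hcomp (adj g) w)) => x.
  by rewrite adj_hcompE hcompE adjK w_in iw.
- by move=> X /lbs /sle_ule.
- move=> X XB; have T (i : {X | BB X}) := cid ((sleP X (proj1_sig i)).1 (XB _ (proj2_sig i))).
  pose i0 : {X | BB X} := exist _ B0 BB0.
  pose w := hcomp (v i0) (projT1 (T i0)).
  have cw : central w by apply: central_comp; [exact: cv|exact: (projT2 (T i0))].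
  apply: (hom_sle_uclass (V := hcomp (adj g) w)); apply: central_factor => // x.
  apply: g_ran => i.
  exact: (isometric_sub_central cw.1 (cv i) (projT2 (T i)).1).
Qed.

(** The fresh sum J of all central parts of B0 that are strongly below BB. It is
strongly below BB by the universal property, and it strongly contains each of
these parts because they are all bounded by B0. A strong lower bound of BB is one
of these parts. *)
Lemma sle_glb_exists (BB : ucdd R N -> Prop) : (exists X, BB X) ->
  exists X, is_glb sle BB X.
Proof.
move=> [B0 BB0].
pose I0 := {E : csubspace (space (urepr B0)) | red E}.
pose F0 (i : I0) := uclass (sub_tuple (proj2_sig i)).
pose I := {i : I0 | forall Y, BB Y -> sle (F0 i) Y}.
have [J [_ J2 J3]] := fresh_sum_class (fun i : I => F0 (proj1_sig i)).
exists J; split=> [Y BY|X XB].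
  by apply: J2 => -[i Fi]; exact: Fi.
have [V cV] := (sleP X B0).1 (XB _ BB0).
have [E _ [cE eE]] := central_range cV.
have rE : red E := cE.1.
have XE : X = F0 (exist _ E rE).
  apply/ucdd_eqP; have [U uU] := (ueqP _ (sub_tuple rE)).1 eE.
  have [W uW] := uclass_repr (sub_tuple rE).
  by exists (hcomp (adj W) U); apply: unitary_comp => //; exact: unitary_adj.
have lbE Y : BB Y -> sle (F0 (exist _ E rE)) Y by rewrite -XE; exact: XB.
rewrite XE; apply: (J3 _ (exist _ (exist _ E rE) lbE)) => i k _.
by exists B0 => Z [] ->; [exact: (proj2_sig i)|exact: (proj2_sig k)].
Qed.

Lemma lub_unique (T : Type) (le : T -> T -> Prop) (S : T -> Prop) x y :
  (forall u v, le u v -> le v u -> u = v) -> is_lub le S x -> is_lub le S y -> x = y.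
Proof. by move=> anti [xu xl] [yu yl]; apply: anti; [exact: xl|exact: yl]. Qed.

Lemma glb_unique (T : Type) (le : T -> T -> Prop) (S : T -> Prop) x y :
  (forall u v, le u v -> le v u -> u = v) -> is_glb le S x -> is_glb le S y -> x = y.
Proof. by move=> anti [xu xl] [yu yl]; apply: anti; [exact: yl|exact: xl]. Qed.

(** The fresh sum of the members of BB. *)
Lemma exists_lub (BB : ucdd R N -> Prop) : is_set BB ->
  (forall X Y, BB X -> BB Y -> X <> Y -> ub_bounded sle (pair_set X Y)) ->
  exists J, is_lub sle BB J /\ is_lub ule BB J.
Proof.
move=> [I [F FP]] pb; have [J [J1 J2 J3]] := fresh_sum_class F.
have FB i : BB (F i) by apply/FP; exists i.
have ub X : BB X -> sle X J.
  by move=> /FP[i <-]; apply: J3 => k l; exact: pb.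
exists J; split; split=> //; [move=> Y YB|move=> X /ub /sle_ule//|move=> Y YB].
  by apply: J2 => i; exact: YB.
by apply: J1 => i; exact: YB.
Qed.

Lemma pair_is_set X Y : is_set (pair_set X Y).
Proof.
exists bool, (fun b : bool => if b then X else Y) => Z; split=> [[]->|[[] <-]].
- by exists true.
- by exists false.
- by left.
- by right.
Qed.

Lemma pair_join X Y : ub_bounded sle (pair_set X Y) ->
  exists S, [/\ is_lub ule (pair_set X Y) S, sle X S & sle Y S].
Proof.
move=> [Z ZXY].
have [||J [[Ju _] Jl]] := @exists_lub (pair_set X Y); first exact: pair_is_set.
  by move=> U V XU XV _; exists Z => W [] ->; exact: ZXY.
by exists J; split=> //; apply: Ju; [left|right].
Qed.

(** The map (x, y) |-> V x + W y is unitary. *)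
Lemma usum_eq Z X Y (V : hom (urepr X) (urepr Z)) (W : hom (urepr Y) (urepr Z)) :
  isometric V -> isometric W -> (forall x, adj V (W x) = 0) ->
  (forall z, adj V z = 0 -> adj W z = 0 -> z = 0) -> Z = usum X Y.
Proof.
move=> iV iW VW tot; have WV x : adj W (V x) = 0.
  exact: (hom0_adj (T := hcomp (adj V) W) VW x).
pose S := cdd_sum (urepr X) (urepr Y).
pose U := hlincomb 1 (hcomp V (adj (hinl (urepr X) (urepr Y))))
                  (hcomp W (adj (hinr (urepr X) (urepr Y)))).
have UE (u : space S) : U u = V u.1 + W u.2 by rewrite [LHS]hlincombE scale1r.
have UE' z : adj U z = (adj V z, adj W z).
  rewrite [LHS]adj_hlincombE scale1r !adj_hcompE.
  change ((adj V z + 0, 0 + adj W z) = (adj V z, adj W z)).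
  by rewrite addr0 add0r.
have uU : unitary_hom (adj U).
  split=> [z|u].
    apply/eqP; rewrite adjK UE UE' -subr_eq0; apply/eqP; apply: tot.
      by rewrite homB homD iV VW addr0 subrr.
    by rewrite homB homD iW WV add0r subrr.
  by rewrite adjK UE' UE !homD iV iW VW WV addr0 add0r; case: u.
have [T uT] := uclass_repr S.
apply/ucdd_eqP; exists (hcomp (adj T) (adj U)).
by apply: unitary_comp => //; exact: unitary_adj.
Qed.

Lemma isometric_contractive A B (V : hom A B) : isometric V -> contractive V.
Proof.
move=> iV x; rewrite -ler_sqr ?nnegrE ?nrm_ge0//.
by rewrite -lecR -!inner_nrm adjE iV.
Qed.

Lemma contractive_comp A B C (V : hom B C) (W : hom A B) :
  contractive V -> contractive W -> contractive (hcomp V W).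
Proof. by move=> cV cW x; exact: le_trans (cV _) (cW _). Qed.

(** A projection on a reducing subspace compresses to a contractive intertwiner
from A to the complement C; as this is 0, the projection preserves the range of V.
Only contractive intertwiners are available from disjointness, so the definition of
[cred] is checked on projections. *)
Lemma sle_of_disjoint_complement A B C (V : hom A B) (J : hom C B) :
  isometric V -> isometric J ->
  (forall x, V (adj V x) + J (adj J x) = x) ->
  (forall T : hom A C, contractive T -> forall x, T x = 0) ->
  sle (uclass A) (uclass B).
Proof.
move=> iV iJ VJ T0; have [E pE [rE eE]] := isometric_range iV.
exists A, B; split; try by apply/ueqP; exists (hid _); exact: unitary_id.
exists E => //; split=> // K rK.
pose P := hcomp (incl rK) (adj (incl rK)).
(* Projections are contractions, so their corners are governed by [T0]. *)
have cP : contractive P.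
  apply: contractive_comp; last apply: contractive_adj;
  exact/isometric_contractive/inclK.
have key x : proj E (proj K (proj E x)) = proj K (proj E x).
  have := T0 (hcomp (adj J) (hcomp P V)) _ (adj V x).
  rewrite !hcompE -pE => JPV; rewrite [LHS]pE -[RHS]VJ.
  rewrite (_ : adj J (proj K (proj E x)) = 0) ?hom0 ?addr0//; apply: JPV.
  apply: contractive_comp; first exact/contractive_adj/isometric_contractive.
  by apply: contractive_comp => //; exact: isometric_contractive.
move=> x; apply: inner_ext => z.
by rewrite proj_adj proj_adj -key -proj_adj -proj_adj -proj_adj key.
Qed.

(** The bound is Z + X + Y: the complement of Z + X in it is Y, which is disjoint
from Z and from X, and likewise for Z + Y. *)
Lemma decomposed_bounded (A0 B0 : ucdd R N) X Y Z : is_boxplus A0 Z X -> is_boxplus B0 Z Y ->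
  uperp X Y -> ub_bounded sle (pair_set A0 B0).
Proof.
move=> [-> ZX] [-> ZY] XY; pose x := urepr X; pose y := urepr Y; pose z := urepr Z.
pose C := cdd_sum (cdd_sum z x) y.
have inl_iso A B : isometric (hinl A B) by [].
have inr_iso A B : isometric (hinr A B) by [].
have zero (A B D : cdd_tuple R N) (T : hom (cdd_sum A B) D) :
    (forall S : hom A D, contractive S -> forall a, S a = 0) ->
    (forall S : hom B D, contractive S -> forall a, S a = 0) ->
    contractive T -> forall u, T u = 0.
  move=> A0' B0' cT [a b].
  have -> : (a, b) = hinl A B a + hinr A B b :> space (cdd_sum A B).
    by rewrite hinlE hinrE; congr pair; rewrite /= ?addr0 ?add0r.
  rewrite homD -[T (hinl _ _ a)]/(hcomp T (hinl A B) a) -[T (hinr _ _ b)]/(hcomp T (hinr A B) b).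
  rewrite A0' ?B0' ?addr0//; apply: contractive_comp => //; exact: isometric_contractive.
exists (uclass C) => _ [->|->].
  apply: (@sle_of_disjoint_complement _ _ _ (hinl (cdd_sum z x) y) (hinr (cdd_sum z x) y)) => //.
    by case=> a b; congr pair; rewrite /= ?addr0 ?add0r.
  by move=> T; apply: zero => S cS; apply: uperp_hom0 cS.
pose V := hlincomb 1 (hcomp (hinl (cdd_sum z x) y) (hcomp (hinl z x) (adj (hinl z y))))
  (hcomp (hinr (cdd_sum z x) y) (adj (hinr z y))).
pose J := hcomp (hinl (cdd_sum z x) y) (hinr z x).
have VE (u : space (cdd_sum z y)) : V u = (((u.1, 0), u.2) : space C).
  by rewrite [LHS]hlincombE scale1r; congr pair; rewrite /= ?addr0 ?add0r.
have VE' (u : space C) : adj V u = ((u.1.1, u.2) : space (cdd_sum z y)).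
  by rewrite [LHS]adj_hlincombE scale1r; congr pair; rewrite /= ?addr0 ?add0r.
apply: (@sle_of_disjoint_complement _ _ _ V J) => //.
- by move=> u; rewrite VE' VE; case: u.
- move=> [[a b] c]; rewrite VE' VE; congr pair; rewrite /= ?addr0 ?add0r//.
  by congr pair; rewrite /= ?addr0 ?add0r.
move=> T; apply: zero => S cS; first by apply: uperp_hom0 cS.
by apply: uperp_hom0 cS; exact: uperp_sym.
Qed.

(** With V and W the embeddings of A0 and B0 into a common strong bound and
T = (adj W) V, the initial projection adj T T of T is central. The common part E is
the initial space of T, embedded in A0 by inclusion and in B0 by T; the rest of A0
is the kernel of T and the rest of B0 the kernel of adj T. *)
Lemma bounded_decomposed (A0 B0 : ucdd R N) : ub_bounded sle (pair_set A0 B0) ->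
  exists E X Y, [/\ is_boxplus A0 E X, is_boxplus B0 E Y & uperp X Y].
Proof.
move=> [C CAB].
have /sleP[V cV] : sle A0 C by apply: CAB; left.
have /sleP[W cW] : sle B0 C by apply: CAB; right.
pose a := urepr A0; pose b := urepr B0.
pose T : hom a b := hcomp (adj W) V.
have TE x : T x = adj W (V x) by [].
have TE' y : adj T y = adj V (W y) by [].
have vr x : V (adj V (W (adj W (V x)))) = W (adj W (V x)) := central_ran cV (hcomp W (adj W)) x.
have wr y : W (adj W (V (adj V (W y)))) = V (adj V (W y)) := central_ran cW (hcomp V (adj V)) y.
have TTT' y : adj T (T (adj T y)) = adj T y.
  by rewrite (TE' (T _)) TE TE' wr (centralK cV).
have TTC (S : hom a a) x : adj T (T (S x)) = S (adj T (T x)).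
  have := centralC cW (hcomp V (hcomp S (adj V))) (V x).
  rewrite !hcompE (centralK cV) => /(congr1 (adj V)).
  by rewrite (centralK cV).
pose E := equalizer (fun _ : unit => hcomp (adj T) T) (fun _ => hid a).
have rE : red E by exact: equalizer_red.
have EP x : csub_set E x <-> adj T (T x) = x.
  by rewrite equalizerP; split=> [/(_ tt)|? []].
pose X := equalizer (fun _ : unit => T) (fun _ => hzero a b).
have rX : red X by exact: equalizer_red.
have XP x : csub_set X x <-> T x = 0.
  by rewrite equalizerP; split=> [/(_ tt)|? []].
pose Y := equalizer (fun _ : unit => adj T) (fun _ => hzero b a).
have rY : red Y by exact: equalizer_red.
have YP y : csub_set Y y <-> adj T y = 0.
  by rewrite equalizerP; split=> [/(_ tt)|? []].
have [UE uUE] := uclass_repr (sub_tuple rE).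
have [UX uUX] := uclass_repr (sub_tuple rX).
have [UY uUY] := uclass_repr (sub_tuple rY).
pose e := hcomp (incl rE) UE; pose ex := hcomp (incl rX) UX; pose ey := hcomp (incl rY) UY.
have ie : isometric e by apply: isometric_comp; [exact: inclK|exact: uUE.1].
have iex : isometric ex by apply: isometric_comp; [exact: inclK|exact: uUX.1].
have iey : isometric ey by apply: isometric_comp; [exact: inclK|exact: uUY.1].
have Te x : adj T (T (e x)) = e x by apply/EP; exact: csub_valK.
have Tx x : T (ex x) = 0 by apply/XP; exact: csub_valK.
have Ty y : adj T (ey y) = 0 by apply/YP; exact: csub_valK.
have rane x : adj T (T x) = x -> e (adj e x) = x.
  move=> /EP Ex; rewrite adj_hcompE hcompE (uUE.2 _ : UE (adj UE _) = _).
  by rewrite incl_adj proj_id.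
have ranx x : T x = 0 -> ex (adj ex x) = x.
  move=> /XP Ex; rewrite adj_hcompE hcompE (uUX.2 _ : UX (adj UX _) = _).
  by rewrite incl_adj proj_id.
have rany y : adj T y = 0 -> ey (adj ey y) = y.
  move=> /YP Ey; rewrite adj_hcompE hcompE (uUY.2 _ : UY (adj UY _) = _).
  by rewrite incl_adj proj_id.
have ce : central e.
  by apply: central_of_ran => // S x; apply: rane; rewrite TTC Te.
have T0 x : adj T (T x) = 0 -> T x = 0.
  by move=> TTx; apply: inner_self_eq0; rewrite adjE TTx inner0r.
have cex : central ex.
  apply: central_of_ran => // S x; apply: ranx; apply: T0.
  by rewrite TTC Tx !hom0.
have ie' : isometric (hcomp T e) by move=> x; rewrite adj_hcompE hcompE Te ie.
have eex x : adj e (ex x) = 0.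
  by apply: inner_ext => z; rewrite inner0l adjE' -Te -adjE Tx !inner0l.
have eey y : adj e (adj T (ey y)) = 0 by rewrite Ty hom0.
exists (uclass (sub_tuple rE)), (uclass (sub_tuple rX)), (uclass (sub_tuple rY)); split.
- split.
    apply: (usum_eq ie iex eex) => x ex0 xx0.
    have Tx0 : T x = 0.
      apply: T0; rewrite -(rane _ (TTT' (T x))).
      suff -> : adj e (adj T (T x)) = 0 by rewrite hom0.
      apply: inner_ext => z.
      by rewrite inner0l (adjE' e) (adjE' T) (adjE T) Te -(adjE' e) ex0 inner0l.
    by rewrite -(ranx _ Tx0) xx0 hom0.
  apply: hom0_uperp => S x; apply: (central_hom0 ce iex eex).
- split.
    apply: (usum_eq ie' iey) => [y|y ey0 yy0]; first by rewrite adj_hcompE eey.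
    have Ty0 : adj T y = 0 by rewrite -(rane _ (TTT' y)) -adj_hcompE ey0 hom0.
    by rewrite -(rany _ Ty0) yy0 hom0.
  apply: hom0_uperp => S x.
  apply: (central_hom0 (central_comp cV ce) (isometric_comp cW.1 iey)) => y.
  by rewrite adj_hcompE hcompE -TE' eey.
- apply: hom0_uperp => S x.
  apply: (central_hom0 (central_comp cV cex) (isometric_comp cW.1 iey)) => y.
  by rewrite adj_hcompE hcompE -TE' Ty hom0.
Qed.
End Orders.

Theorem theorem6p1 (R : realType) (N : nat) (N_ge1 : (1 <= N)%N)
    (BB : ucdd R N -> Prop) (BB_set : is_set BB) (BB_neq0 : exists X, BB X)
    (A B : ucdd R N) :
  (* (A) *)
  (exists X, is_glb sle BB X)
  /\
  (* (B) *)
  (let pairwise_bounded :=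
     forall X Y, BB X -> BB Y -> X <> Y -> ub_bounded sle (pair_set X Y) in
   ((exists X, is_lub sle BB X) <-> pairwise_bounded) /\
   (pairwise_bounded ->
     (forall X, is_glb sle BB X <-> is_glb ule BB X) /\
     (forall X, is_lub sle BB X <-> is_lub ule BB X)))
  /\
  (* (C) *)
  (let bounded := ub_bounded sle (pair_set A B) in
   let below_join :=
     exists S, [/\ is_lub ule (pair_set A B) S, sle A S & sle B S] in
   let decomposed :=
     exists E X Y, [/\ is_boxplus A E X, is_boxplus B E Y & uperp X Y] in
   (bounded <-> below_join) /\ (below_join <-> decomposed))
  /\
  (* (D) *)
  (ub_bounded sle (pair_set A B) -> (ule A B <-> sle A B)).
Proof.
split; first exact: sle_glb_exists.
split.
  move=> pb; split; first split.
  - move=> [J [Jub _]] X Y BX BY _.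
    by exists J => Z [] ->; exact: Jub.
  - by move=> /(exists_lub BB_set)[J [sJ _]]; exists J.
  move=> /(exists_lub BB_set)[J [sJ uJ]].
  have [G [sG uG]] := exists_glb BB_neq0 sJ.1.
  split=> X; split=> h.
  - by rewrite (glb_unique (@sle_antisym R N) h sG).
  - by rewrite (glb_unique (@ule_antisym R N) h uG).
  - by rewrite (lub_unique (@sle_antisym R N) h sJ).
  - by rewrite (lub_unique (@ule_antisym R N) h uJ).
have below_bounded S : sle A S -> sle B S -> ub_bounded sle (pair_set A B).
  by move=> AS BS; exists S => Z [] ->.
split.
  split; split; try exact: pair_join.
  - by move=> [S [_ AS BS]]; exact: below_bounded BS.
  - by move=> [S [_ AS BS]]; apply: bounded_decomposed; exact: below_bounded BS.
  - by move=> [E [X [Y [AE BE XY]]]]; apply: pair_join; exact: decomposed_bounded AE BE XY.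
move=> [C CAB]; split=> [AB|]; last exact: sle_ule.
by apply: (sle_of_ule _ _ AB); apply: CAB; [left|right].
Qed.
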